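(* In the setting of the context, assume every irreducible $T$-module is thin. Then there exists a unique $\mathbf{C}\in T$ such that $$\mathbf{A}+\frac{q\mathbf{B}\mathbf{C}-q^{-1}\mathbf{C}\mathbf{B}}{q^2-q^{-2}}=\frac{(\mathbf{a}+\mathbf{a}^{-1})(\Lambda+\Lambda^{-1})+(\mathbf{b}+\mathbf{b}^{-1})(\mathbf{c}+\mathbf{c}^{-1})}{q+q^{-1}},$$ $$\mathbf{B}+\frac{q\mathbf{C}\mathbf{A}-q^{-1}\mathbf{A}\mathbf{C}}{q^2-q^{-2}}=\frac{(\mathbf{b}+\mathbf{b}^{-1})(\Lambda+\Lambda^{-1})+(\mathbf{c}+\mathbf{c}^{-1})(\mathbf{a}+\mathbf{a}^{-1})}{q+q^{-1}},$$ $$\mathbf{C}+\frac{q\mathbf{A}\mathbf{B}-q^{-1}\mathbf{B}\mathbf{A}}{q^2-q^{-2}}=\frac{(\mathbf{c}+\mathbf{c}^{-1})(\Lambda+\Lambda^{-1})+(\mathbf{a}+\mathbf{a}^{-1})(\mathbf{b}+\mathbf{b}^{-1})}{q+q^{-1}}.$$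
   Context: Fix a nonzero $q\in\mathbb{C}$ with $q^4\neq1$. Let $\Gamma$ be a finite connected distance-regular graph (undirected, no loops or multiple edges) with vertex set $X$, distance $\partial$, diameter $D\ge3$; $V=\mathbb{C}^X$. $A$ is the adjacency matrix, $E_0,\dots,E_D$ the primitive idempotents of the Bose–Mesner algebra with $E_0=|X|^{-1}J$ and $E_1,\dots,E_D$ a $Q$-polynomial ordering; $A=\sum\theta_iE_i$. Fix a vertex $x$; $E_i^*$ is the diagonal $0/1$ matrix projecting onto vertices at distance $i$ from $x$; $A^*$ is diagonal with $(y,y)$-entry $|X|(E_1)_{xy}$, $A^*=\sum\theta_i^*E_i^*$; $T$ is the algebra generated by $A,A^*$. Assume $q$-Racah type: $\theta_i=w+uq^{2i-D}+vq^{D-2i}$, $\theta_i^*=w^*+u^*q^{2i-D}+v^*q^{D-2i}$, $u,u^*,v,v^*\neq0$; fix $a,b$ with $a^2=u/v$, $b^2=u^*/v^*$; $\mathbf{A}=(A-wI)/(av)$, $\mathbf{B}=(A^*-w^*I)/(bv^* )$. For an irreducible $T$-module $W\subseteq V$: endpoint $\rho=\min\{i:E_i^*W\ne0\}$, dual endpoint $\tau=\min\{i:E_iW\neq0\}$, diameter $d=|\{i:E^*_iW\ne0\}|-1$; thin means $\dim E^*_iW\le1$ for all $i$. Put $a(W)=aq^{2\tau+d-D}$, $b(W)=bq^{2\rho+d-D}$. If $W$ is thin, $(\mathbf{A}|_W,\{E_{\tau+i}|_W\}_{i=0}^d,\mathbf{B}|_W,\{E^*_{\rho+i}|_W\}_{i=0}^d)$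 is a Leonard system with eigenvalues $\vartheta_i=a(W)q^{2i-d}+a(W)^{-1}q^{d-2i}$ and dual eigenvalues $\vartheta^*_i=b(W)q^{2i-d}+b(W)^{-1}q^{d-2i}$; let $\kappa=0$ if $d=0$ and, for $d\ge1$, $\kappa=a(W)b(W)^{-1}q^{d-1}+a(W)^{-1}b(W)q^{1-d}+\phi_1/((q-q^{-1})(q^d-q^{-d}))$ where $\phi_1=(\vartheta^*_0-\vartheta^*_1)(\mathrm{trace}(E^*_\rho\mathbf{A}|_W)-\vartheta_d)$; $c(W)$ is a root of $\xi^2-\kappa\xi+1=0$ (defined up to reciprocal). Isomorphism of irreducible modules: linear bijection commuting with $T$; $\Psi$ = set of types; for $\psi\in\Psi$, $a(\psi),b(\psi),d(\psi),c(\psi)$ are $a(W),b(W)$, the diameter, and (a fixed choice of) $c(W)$ for $W$ of type $\psi$. $V_\psi$ = span of irreducible modules of type $\psi$, $V=\bigoplus_\psi V_\psi$, $e_\psi$ = identity on $V_\psi$, $0$ on other $V_\lambda$. Define $\mathbf{a}=\sum_\psi a(\psi)e_\psi$, $\mathbf{b}=\sum_\psi b(\psi)e_\psi$, $\mathbf{c}=\sum_\psi c(\psi)e_\psi$, $\Lambda=\sum_\psi q^{d(\psi)+1}e_\psi$ (these are invertible). *)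

(* Defs.v *)
From HB Require Import structures.
From mathcomp Require Import all_boot all_order all_algebra.
From mathcomp Require Import complex reals.
Set Implicit Arguments. Unset Strict Implicit. Unset Printing Implicit Defensive.
Import Order.TTheory GRing.Theory Num.Theory.
Local Open Scope ring_scope.

Section Graph.
Variables (n : nat) (adj : rel 'I_n).

Fixpoint ball (x : 'I_n) (k : nat) : {set 'I_n} :=
  match k with
  | 0 => [set x]
  | k'.+1 => ball x k' :|: [set z | [exists y in ball x k', adj y z]]
  end.

(* path-length distance (for a connected graph; n if unreachable) *)
Definition gdist (x y : 'I_n) : nat := find (fun k => y \in ball x k) (iota 0 n).

Definition simple_graph : Prop := symmetric adj /\ irreflexive adj.
Definition gconnected : Prop := forall x y, exists k, y \in ball x k.

Definition diam : nat := \max_(x : 'I_n) \max_(y : 'I_n) gdist x y.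

Definition distance_regular : Prop :=
  forall x y x' y', gdist x y = gdist x' y' -> forall i j,
    #|[set z | (gdist x z == i) && (gdist y z == j)]| =
    #|[set z | (gdist x' z == i) && (gdist y' z == j)]|.
End Graph.

(* Vectors of V = C^X are column vectors; a matrix M acts by v |-> M v.*)
Section Matrices.
Variables (C : fieldType) (n : nat) (adj : rel 'I_n).

Definition adjmx : 'M[C]_n := \matrix_(y, z) (adj y z)%:R.
Definition distmx (i : nat) : 'M[C]_n := \matrix_(y, z) (gdist adj y z == i)%:R.

Definition inBM (M : 'M[C]_n) : Prop :=
  exists c : nat -> C, M = \sum_(i < (diam adj).+1) c i *: distmx i.

Definition prim_idem (F : 'M[C]_n) : Prop :=
  [/\ inBM F, F *m F = F, F != 0 &
      forall G, inBM G -> G *m G = G -> G *m F = F \/ G *m F = 0].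

Definition hada (M N : 'M[C]_n) : 'M[C]_n := \matrix_(y, z) (M y z * N y z).

(* Q-polynomial ordering E_0..E_D (Krein conditions: q^h_{1j} = 0 if |h-j|>1
   and q^h_{1j} <> 0 if |h-j| = 1, where (E_1 o E_j) E_h = |X|^-1 q^h_{1j} E_h) *)
Definition Qpolynomial (E : nat -> 'M[C]_n) (D : nat) : Prop :=
  forall h j, (h <= D)%N -> (j <= D)%N ->
    ((1 < h - j)%N || (1 < j - h)%N -> hada (E 1%N) (E j) *m E h = 0) /\
    ((h == j.+1) || (j == h.+1) -> hada (E 1%N) (E j) *m E h != 0).

Definition Estar (x : 'I_n) (i : nat) : 'M[C]_n :=
  \matrix_(y, z) ((y == z) && (gdist adj x y == i))%:R.

Definition Astarmx (E1 : 'M[C]_n) (x : 'I_n) : 'M[C]_n :=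
  \matrix_(y, z) ((y == z)%:R * (n%:R * E1 x y)).
End Matrices.

Inductive inT (C : fieldType) (n : nat) (A As : 'M[C]_n) : 'M[C]_n -> Prop :=
  | inT1 : inT A As 1%:M
  | inTA : inT A As A
  | inTAs : inT A As As
  | inTadd M N : inT A As M -> inT A As N -> inT A As (M + N)
  | inTscale c M : inT A As M -> inT A As (c *: M)
  | inTmul M N : inT A As M -> inT A As N -> inT A As (M *m N).

Section Modules.
Variables (C : fieldType) (n : nat) (A As : 'M[C]_n).

(* A subspace W of V = C^n (column vectors) is represented by a matrix whose
   rows are the transposes of vectors spanning W.  M w is represented by
   the rows of W *m M^T. *)
Definition Tmodule (W : 'M[C]_n) : Prop :=
  forall M, inT A As M -> (W *m M^T <= W)%MS.

Definition irreducible (W : 'M[C]_n) : Prop :=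
  [/\ Tmodule W, \rank W != 0%N &
      forall U : 'M[C]_n, (U <= W)%MS -> Tmodule U -> \rank U = 0%N \/ (U == W)%MS].

Definition Tiso (W1 W2 : 'M[C]_n) : Prop :=
  exists P : 'M[C]_n,
    [/\ (W1 *m P^T == W2)%MS, \rank (W1 *m P^T) = \rank W1 &
        forall M, inT A As M -> W1 *m M^T *m P^T = W1 *m P^T *m M^T].

Definition acts_as_scalar (f : 'M[C]_n -> C) (M : 'M[C]_n) : Prop :=
  forall W, irreducible W -> W *m M^T = f W *: W.
End Modules.

Section ModuleParams.
Variables (C : fieldType) (n : nat) (adj : rel 'I_n) (x : 'I_n) (D : nat).
Variable E : nat -> 'M[C]_n.

Definition dimEstar (W : 'M[C]_n) (i : nat) : nat := \rank (W *m (Estar C adj x i)^T).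

Definition endpoint (W : 'M[C]_n) : nat := find (fun i => dimEstar W i != 0%N) (iota 0 D.+1).
Definition dual_endpoint (W : 'M[C]_n) : nat :=
  find (fun i => \rank (W *m (E i)^T) != 0%N) (iota 0 D.+1).
Definition mod_diam (W : 'M[C]_n) : nat := (count (fun i => dimEstar W i != 0%N) (iota 0 D.+1)).-1.

Definition thin (W : 'M[C]_n) : Prop := forall i, (dimEstar W i <= 1)%N.

(* trace of the restriction of M to the (M-invariant) subspace W *)
Definition restr_trace (W M : 'M[C]_n) : C :=
  \tr (row_base W *m M^T *m pinvmx (row_base W)).
End ModuleParams.

Section QRacah.
Variables (C : fieldType) (n : nat) (adj : rel 'I_n) (x : 'I_n) (D : nat).
Variables (E : nat -> 'M[C]_n) (q a b : C) (Abold : 'M[C]_n).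

Definition qpow (z : int) : C := q ^ z.

Definition aW (W : 'M[C]_n) : C :=
  a * qpow ((2 * dual_endpoint D E W + mod_diam adj x D W)%N%:Z - D%:Z).
Definition bW (W : 'M[C]_n) : C :=
  b * qpow ((2 * endpoint adj x D W + mod_diam adj x D W)%N%:Z - D%:Z).

(* eigenvalues and dual eigenvalues of the Leonard system on W *)
Definition vartheta (W : 'M[C]_n) (i : nat) : C :=
  let d := mod_diam adj x D W in
  aW W * qpow ((2 * i)%N%:Z - d%:Z) + (aW W)^-1 * qpow (d%:Z - (2 * i)%N%:Z).
Definition varthetas (W : 'M[C]_n) (i : nat) : C :=
  let d := mod_diam adj x D W in
  bW W * qpow ((2 * i)%N%:Z - d%:Z) + (bW W)^-1 * qpow (d%:Z - (2 * i)%N%:Z).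

Definition phi1 (W : 'M[C]_n) : C :=
  (varthetas W 0 - varthetas W 1) *
  (restr_trace W (Estar C adj x (endpoint adj x D W) *m Abold)
   - vartheta W (mod_diam adj x D W)).

Definition kappa (W : 'M[C]_n) : C :=
  let d := mod_diam adj x D W in
  if d == 0%N then 0 else
    aW W / bW W * qpow (d%:Z - 1) + bW W / aW W * qpow (1 - d%:Z)
    + phi1 W / ((q - q^-1) * (q ^+ d - q ^- d)).
End QRacah.

(* Main.v *)
(* The third equation determines C, so only the first two equations and the
   membership of C in T have to be proved.

   The generators A and A* are Hermitian, so V is a sum of irreducible
   T-modules and T is its own bicommutant.  A matrix acting on every irreducible
   module as a scalar that depends only on the isomorphism class commutes with
   the commutant of T, hence lies in T; this gives C in T, and it reduces the
   two equations to a fixed irreducible module W.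

   On W, substituting C turns them into Askey-Wilson relations between A and B.
   Thinness makes A irreducible tridiagonal on the spaces E*_i W and forces the
   spaces E_i W to be lines as well.  Starting from a vector u_0 spanning
   E*_rho W, put u_(i+1) = u_i (A - vartheta_(d-i)); then
   u_i B = vartheta*_i u_i + phi_i u_(i-1).  The tridiagonal shape of A seen from
   E*_rho W, namely W (B - vartheta*_1)(B - vartheta*_0) A E*_rho = 0, is a
   recurrence for the phi_i whose solution is
     phi_i = [i] [d+1-i] (kappa - (a/b) q^(d-2i+1) - (b/a) q^(2i-d-1)),
   [i] = q^i - q^(-i), where kappa is read off phi_1.  (When q^(2d+2) = 1 the
   Askey-Wilson relations alone would not determine the phi_i.)  With these phi_i
   both relations are rational identities on each u_i. *)
Require Import Defs.
From HB Require Import structures.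
From mathcomp Require Import all_boot all_order all_algebra.
From mathcomp Require Import complex reals.
From mathcomp Require Import boolp zify ring.
Import Order.TTheory GRing.Theory Num.Theory.
Local Open Scope ring_scope.

Set Implicit Arguments.
Unset Strict Implicit.
Unset Printing Implicit Defensive.

(** * The Askey-Wilson relations in split form *)

(** The Leonard system structure of a thin module is rederived rather than assumed, and two flags
    carry the argument. The vector u_i lies in E*_rho W + ... + E*_(rho+i) W because A is
    tridiagonal there, and in E_tau W + ... + E_(tau+d-i) W because the factors A - vartheta_d, ...,
    A - vartheta_(d-i+1) have been applied. Together the flags leave only two terms in u_i B. The
    recurrence holds because (B - vartheta*_1)(B - vartheta*_0) erases the components at rho and
    rho+1, while A moves the index by at most one. It is a first-order recurrence for the
    differences of phi_i / (vartheta*_i - vartheta*_0) - vartheta_(d-i+1), so two constants stay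
    free; phi_1 and phi_(d+1) = 0 fix them. Distinctness of the eigenvalues gives q^(2i) <> 1 only
    for 1 <= i <= D. When d = D this says nothing about q^(2d+2), so the solution must never divide
    by [d+1]. Distinctness is itself derived: for A from degrees of polynomials in A, for A* from
    the Krein conditions. *)

Section SplitForm.
Variables (F : fieldType) (q s t : F) (d : nat).
Hypotheses (q0 : q != 0) (s0 : s != 0) (t0 : t != 0).

Definition qn (i : nat) : F := q ^+ i - q ^- i.
(** With [s = a(W) q^d] this is vartheta_(d-i): the eigenvalues are used in descending order. With
    [t = b(W) q^(-d)], [dual_eig i] is vartheta*_i. *)
Definition eig_desc (i : nat) : F := s * q ^- (2 * i) + s^-1 * q ^+ (2 * i).
Definition dual_eig (i : nat) : F := t * q ^+ (2 * i) + t^-1 * q ^- (2 * i).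
(** The second factor of a difference of dual eigenvalues, see [zetaB]. *)
Definition sfac (i : nat) : F := t * q ^+ i - t^-1 * q ^- i.

(** The first factor vanishes at [i = 0] and the second at [i = d+1]. Hence the action of [B] can be
    stated for all natural indices once u_(d+1) = 0. *)
Definition split_phi (kap : F) (i : nat) : F :=
  qn i * (q ^+ d.+1 / q ^+ i - q ^+ i / q ^+ d.+1) *
  (kap - s / t / q ^+ d * q / q ^+ (2 * i) - t / s * q ^+ d / q * q ^+ (2 * i)).

Lemma q_expS k : q ^+ (2 * k.+1) = q ^+ 2 * q ^+ (2 * k).
Proof. by rewrite -exprD mulnS. Qed.

Lemma q_exp_dbl k : q ^+ (2 * k) = q ^+ k * q ^+ k.
Proof. by rewrite -exprD mul2n addnn. Qed.

Lemma qn_neq0 k : (qn k != 0) = (q ^+ (2 * k) != 1).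
Proof.
have qk : q ^+ k != 0 by rewrite expf_neq0.
have -> : qn k = (q ^+ (2 * k) - 1) / q ^+ k by rewrite /qn q_exp_dbl; field.
by rewrite mulf_eq0 invr_eq0 (negPf qk) orbF subr_eq0.
Qed.

Section Relations.
Variable kap : F.

(** The scalars by which the right-hand sides act on a module, with [kap] standing for c + c^-1:
    [aw_alpha a b] for the first equation, [aw_alpha b a] for the second, [aw_gamma a b] for the
    third. *)
Definition aw_alpha (y z : F) : F :=
  ((y + y^-1) * (q ^+ d.+1 + q ^- d.+1) + (z + z^-1) * kap) / (q + q^-1).

Definition aw_gamma (y z : F) : F :=
  (kap * (q ^+ d.+1 + q ^- d.+1) + (y + y^-1) * (z + z^-1)) / (q + q^-1).

Variables (n : nat) (A B : 'M[F]_n) (u : nat -> 'rV[F]_n).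
Hypothesis uA : forall i, u i *m A = eig_desc i *: u i + u i.+1.
Hypothesis uB0 : u 0 *m B = dual_eig 0 *: u 0.
Hypothesis uBS : forall i,
  u i.+1 *m B = dual_eig i.+1 *: u i.+1 + split_phi kap i.+1 *: u i.
Hypothesis q4 : q ^+ 4 != 1.

Let a := s / q ^+ d.
Let b := t * q ^+ d.

Let q1' : q * q + 1 != 0.
Proof.
apply: contraNneq q4 => h; have -> : q ^+ 4 = 1 + (q * q - 1) * (q * q + 1) by ring.
by rewrite h mulr0 addr0.
Qed.

Let q4' : q * q * (q * q) - 1 != 0.
Proof. by have := q4; rewrite -subr_eq0 !exprS expr0 mulr1 !mulrA. Qed.

Let qk0 k : q ^+ k != 0.
Proof. by rewrite expf_neq0. Qed.

(** This is the first equation with C replaced by [aw_gamma - (q A B - q^-1 B A) / (q^2 - q^-2)].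
    The resulting cubic expression is unchanged when all products are reversed, so acting on rows
    from the right is harmless. The coefficients of u_(i-2), ..., u_(i+1) agree for every value of
    [kap]. *)
Lemma split_aw_A i :
  u i *m A + (q ^+ 2 - q ^- 2)^-1 *: (((q - q^-1) * aw_gamma a b) *: (u i *m B)
    - (q ^+ 2 - q ^- 2)^-1 *: ((q ^+ 2 + q ^- 2) *: (u i *m B *m A *m B)
      - u i *m A *m B *m B - u i *m B *m B *m A)) = aw_alpha a b *: u i.
Proof.
(* [B] lowers the index by at most one and occurs at most twice in a term, so [i = 0] and [i = 1]
   are the boundary cases. *)
case: i => [|[|i]]; rewrite !(uB0, uA, mulmxDl, =^~ scalemxAl, uBS);
  apply/rowP => j; rewrite !mxE /aw_gamma /aw_alpha /a /b /split_phi /qn /eig_desc /dual_eig.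
  move: (u 0 0 j) (u 1 0 j) (u 2 0 j) => U0 U1 U2.
  move: (qk0 d); rewrite !q_expS !muln0 !exprS !expr0; move: (q ^+ d) => Y Y0.
  by field; rewrite ?q0 ?s0 ?t0 ?Y0 ?q4' ?q1' ?oner_neq0.
  move: (u 0 0 j) (u 1 0 j) (u 2 0 j) (u 3 0 j) => U0 U1 U2 U3.
  move: (qk0 d); rewrite !q_expS !muln0 !exprS !expr0; move: (q ^+ d) => Y Y0.
  by field; rewrite ?q0 ?s0 ?t0 ?Y0 ?q4' ?q1' ?oner_neq0.
move: (u i 0 j) (u i.+1 0 j) (u i.+2 0 j) (u i.+3 0 j) (u i.+4 0 j) => U0 U1 U2 U3 U4.
move: (qk0 d) (qk0 i); rewrite !q_expS !q_exp_dbl !exprS; move: (q ^+ d) (q ^+ i) => Y Z Y0 Z0.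
by field; rewrite ?q0 ?s0 ?t0 ?Y0 ?Z0 ?q4' ?q1' ?oner_neq0.
Qed.

Lemma split_aw_B i :
  u i *m B + (q ^+ 2 - q ^- 2)^-1 *: (((q - q^-1) * aw_gamma a b) *: (u i *m A)
    - (q ^+ 2 - q ^- 2)^-1 *: ((q ^+ 2 + q ^- 2) *: (u i *m A *m B *m A)
      - u i *m A *m A *m B - u i *m B *m A *m A)) = aw_alpha b a *: u i.
Proof.
case: i => [|[|i]]; rewrite !(uB0, uA, mulmxDl, =^~ scalemxAl, uBS);
  apply/rowP => j; rewrite !mxE /aw_gamma /aw_alpha /a /b /split_phi /qn /eig_desc /dual_eig.
  move: (u 0 0 j) (u 1 0 j) (u 2 0 j) => U0 U1 U2.
  move: (qk0 d); rewrite !q_expS !muln0 !exprS !expr0; move: (q ^+ d) => Y Y0.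
  by field; rewrite ?q0 ?s0 ?t0 ?Y0 ?q4' ?q1' ?oner_neq0.
  move: (u 0 0 j) (u 1 0 j) (u 2 0 j) (u 3 0 j) => U0 U1 U2 U3.
  move: (qk0 d); rewrite !q_expS !muln0 !exprS !expr0; move: (q ^+ d) => Y Y0.
  by field; rewrite ?q0 ?s0 ?t0 ?Y0 ?q4' ?q1' ?oner_neq0.
move: (u i 0 j) (u i.+1 0 j) (u i.+2 0 j) (u i.+3 0 j) (u i.+4 0 j) => U0 U1 U2 U3 U4.
move: (qk0 d) (qk0 i); rewrite !q_expS !q_exp_dbl !exprS; move: (q ^+ d) (q ^+ i) => Y Z Y0 Z0.
by field; rewrite ?q0 ?s0 ?t0 ?Y0 ?Z0 ?q4' ?q1' ?oner_neq0.
Qed.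
End Relations.

(** * Solving the tridiagonality recurrence for the split coefficients *)

Section Recurrence.
Variables (p f : nat -> F).
Hypothesis d0 : (0 < d)%N.
Hypothesis qn0 : forall i, (0 < i <= d)%N -> qn i != 0.
Hypothesis zeta_inj : forall i j, (i <= d)%N -> (j <= d)%N -> dual_eig i = dual_eig j -> i = j.
Hypothesis f00 : f 0 = 1.
Hypothesis p_last : p d.+1 = 0.
Hypothesis p_neq0 : forall i, (0 < i <= d)%N -> p i != 0.
Hypothesis f_rec : forall i, (i <= d)%N ->
  dual_eig 0 * f i.+1 = dual_eig i.+1 * f i.+1 + p i.+1 * f i.
Hypothesis f_last : f d.+1 = 0.
(** In the application [f i] is the coordinate of u_i at E*_rho. Likewise [g i] is that of u_i A,
    and [h i] that of u_(i+1) (B - vartheta*_0) A. *)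
Let g i := eig_desc i * f i + f i.+1.
Let h i := (dual_eig i.+1 - dual_eig 0) * g i.+1 + p i.+1 * g i.
Hypothesis h_rec : forall i, (i.+2 <= d)%N -> (dual_eig i.+2 - dual_eig 1) * h i.+1 + p i.+2 * h i = 0.

Let qk0 k : q ^+ k != 0.
Proof. by rewrite expf_neq0. Qed.

Lemma zetaB i k : dual_eig (i + k) - dual_eig i = qn k * sfac (2 * i + k).
Proof.
rewrite /dual_eig /qn /sfac !q_exp_dbl (exprD q (2 * i)) q_exp_dbl exprD.
by move: (qk0 i) (qk0 k); move: (q ^+ i) (q ^+ k) => Y Z Y0 Z0; field; rewrite ?q0 ?t0 ?Y0 ?Z0.
Qed.

Let zeta0_neq i : (0 < i <= d)%N -> dual_eig i - dual_eig 0 != 0.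
Proof.
move=> /andP[i0 id]; rewrite subr_eq0; apply/eqP => /zeta_inj e.
by rewrite e in i0.
Qed.

Let s_neq0 i : (0 < i <= d)%N -> sfac i != 0.
Proof.
move=> hi; have := zeta0_neq hi.
by rewrite -[i in dual_eig i]add0n zetaB mulf_eq0 negb_or => /andP[].
Qed.

Let f_neq0 i : (i <= d)%N -> f i != 0.
Proof.
elim: i => [|i IH] id; first by rewrite f00 oner_neq0.
have hi : (0 < i.+1 <= d)%N by [].
have e : (dual_eig i.+1 - dual_eig 0) * f i.+1 = - (p i.+1 * f i).
  by rewrite mulrBl (f_rec (ltnW id)); ring.
apply/eqP => f0; move: e; rewrite f0 mulr0 => /esym/eqP.
by rewrite oppr_eq0 mulf_eq0 (negPf (p_neq0 hi)) (negPf (IH (ltnW id))).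
Qed.

(** By [f_rec], [- P i] is the ratio of [f i] to [f i.-1]. At [d.+1] the denominator may vanish, but
    the numerator is 0, so [P d.+1 = 0] in any case. *)
Let P i := p i / (dual_eig i - dual_eig 0).
Let r i := P i - eig_desc i.-1.

Let Plast : P d.+1 = 0. Proof. by rewrite /P p_last mul0r. Qed.

Let fP i : (i <= d)%N -> f i.+1 = - P i.+1 * f i.
Proof.
rewrite leq_eqVlt => /orP[/eqP-> | id]; first by rewrite f_last Plast oppr0 mul0r.
have z := zeta0_neq (id : (0 < i.+1 <= d)%N).
apply: (mulfI z); rewrite mulrBl (f_rec (ltnW id)) /P; field.
exact: z.
Qed.

(** The ratios turn [g i] into [- f i * r i.+1], so [h] becomes a multiple of a difference of [r];
    this makes [h_rec] a first-order recurrence. *)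
Let hP i : (i < d)%N -> h i = f i.+1 * (dual_eig i.+1 - dual_eig 0) * (r i.+1 - r i.+2).
Proof.
move=> id; rewrite /h /g /r /= (fP id) (fP (ltnW id)).
have z := zeta0_neq (id : (0 < i.+1 <= d)%N).
have -> : p i.+1 = P i.+1 * (dual_eig i.+1 - dual_eig 0) by rewrite /P divfK.
by ring.
Qed.

Let Delta i := r i.+1 - r i.+2.

Let Delta_rec i : (i.+2 <= d)%N ->
  (dual_eig i.+2 - dual_eig 1) * Delta i.+1 = (dual_eig i.+1 - dual_eig 0) * Delta i.
Proof.
move=> id; have := h_rec id; rewrite (hP id) (hP (ltnW id)).
have z := zeta0_neq (id : (0 < i.+2 <= d)%N).
have -> : p i.+2 = P i.+2 * (dual_eig i.+2 - dual_eig 0) by rewrite /P divfK.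
move: (fP (ltnW id)) (f_neq0 id) => e f0 H.
apply/eqP; rewrite -subr_eq0; apply/eqP; apply: (mulfI (mulf_neq0 f0 z)).
by rewrite mulr0 -H /Delta e; ring.
Qed.

(** By [zetaB] the two coefficients in [Delta_rec] are [i+1] sfac(i+3) and [i+1] sfac(i+1). After
    cancelling [i+1] the recurrence says that this product is constant. *)
Let Delta_closed i : (i < d)%N ->
  Delta i * (sfac i.+1 * sfac i.+2) = Delta 0 * (sfac 1 * sfac 2).
Proof.
elim: i => // i IH id; rewrite -IH 1?ltnW //.
have := Delta_rec id.
have -> : dual_eig i.+2 - dual_eig 1 = qn i.+1 * sfac i.+3 by rewrite -(zetaB 1 i.+1) addnC addn1.
have -> : dual_eig i.+1 - dual_eig 0 = qn i.+1 * sfac i.+1 by rewrite -(zetaB 0 i.+1) add0n.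
rewrite -!mulrA => /(mulfI (qn0 (ltnW id : (0 < i.+1 <= d)%N))) e.
transitivity (sfac i.+3 * Delta i.+1 * sfac i.+2); first by ring.
by rewrite e; ring.
Qed.

(** The sum of 1 / (sfac(j) sfac(j+1)) over 1 <= j <= i telescopes to [i] / ([1] sfac(1) sfac(i+1)).
    Denominators are cleared because [sfac d.+1], which occurs at [i = d], may be zero. *)
Let r_closed i : (i <= d)%N ->
  (r 1 - r i.+1) * (sfac i.+1 * qn 1) = Delta 0 * sfac 2 * qn i.
Proof.
elim: i => [|i IH] id; first by rewrite /qn expr0 invr1; ring.
case: i => [|i] in IH id *; first by rewrite /Delta mulrA.
have e := IH (ltnW id).
have s0' : sfac i.+2 != 0 by apply: s_neq0.
have D := Delta_closed id.
apply: (mulIf s0').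
have -> : (r 1 - r i.+3) * (sfac i.+3 * qn 1) * sfac i.+2 =
  (r 1 - r i.+2) * (sfac i.+2 * qn 1) * sfac i.+3
  + Delta i.+1 * (sfac i.+2 * sfac i.+3) * qn 1 by rewrite /Delta; ring.
rewrite e D -[Delta 0 * _ * _ * _]mulrA -[Delta 0 * _ * _ * sfac i.+2]mulrA.
rewrite [Delta 0 * _ * qn 1](_ : _ = Delta 0 * sfac 2 * (sfac 1 * qn 1)); last by ring.
rewrite -mulrDr; congr (_ * _); rewrite /qn /sfac !exprS.
by move: (qk0 i); move: (q ^+ i) => Y Y0; field; rewrite ?q0 ?t0 ?Y0.
Qed.

(** The displayed value of [kap] is the one that makes [split_phi] equal to [p 1] at index 1. *)
Lemma split_phi_unique i : (0 < i <= d)%N ->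
  p i = split_phi (s / t / q ^+ d / q + t / s * q ^+ d * q + p 1 / (qn 1 * qn d)) i.
Proof.
case: i => [|i]; first by rewrite ltnn.
move=> /= id.
have z := zeta0_neq (id : (0 < i.+1 <= d)%N).
have z1 := zeta0_neq (d0 : (0 < 1 <= d)%N).
have si := s_neq0 (id : (0 < i.+1 <= d)%N).
have s1 := s_neq0 (d0 : (0 < 1 <= d)%N).
have qnd : qn d != 0 by apply: qn0; rewrite d0 leqnn.
have qn1 : qn 1 != 0 by apply: qn0.
have e1 := r_closed (leqnn d).
have e2 := r_closed (ltnW id).
(* [Delta 0] is eliminated between the closed forms at [d] and at [i]. As [r d.+1] is known from
   [Plast], this expresses [P i.+1] through [P 1]. *)
have E : (r 1 - r i.+1) * sfac i.+1 * qn d = (r 1 - r d.+1) * sfac d.+1 * qn i.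
  apply: (mulIf qn1); transitivity (Delta 0 * sfac 2 * qn i * qn d).
    by rewrite -e2; ring.
  by rewrite mulrAC -e1; ring.
have -> : p i.+1 = P i.+1 * (dual_eig i.+1 - dual_eig 0) by rewrite /P divfK.
have p1E : p 1 = P 1 * (dual_eig 1 - dual_eig 0) by rewrite /P divfK.
have PE : P i.+1 = P 1 - eig_desc 0 + eig_desc i -
    (P 1 - eig_desc 0 + eig_desc d) * sfac d.+1 * qn i / (sfac i.+1 * qn d).
  move: E; rewrite /r Plast /= sub0r opprK => E.
  have -> : (P 1 - eig_desc 0 + eig_desc d) * sfac d.+1 * qn i / (sfac i.+1 * qn d)
    = P 1 - eig_desc 0 - (P i.+1 - eig_desc i).
    by apply: (mulIf (mulf_neq0 si qnd)); rewrite divfK ?mulf_neq0 // -E; ring.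
  by ring.
rewrite p1E PE.
have -> : dual_eig i.+1 - dual_eig 0 = qn i.+1 * sfac i.+1 by rewrite -(zetaB 0 i.+1) add0n.
have -> : dual_eig 1 - dual_eig 0 = qn 1 * sfac 1 by rewrite -(zetaB 0 1) add0n.
have -> : P 1 * (qn 1 * sfac 1) / (qn 1 * qn d) = P 1 * sfac 1 / qn d.
  by move: qn1 qnd; move: (qn 1) (qn d) => x y x0 y0; field; rewrite x0 y0.
move: si qnd (qk0 d) (qk0 i); rewrite /split_phi.
rewrite -(mulrA (P 1 - eig_desc 0 + eig_desc d)).
move: (P 1) => P1; rewrite /qn /sfac /eig_desc muln0 expr0 !q_expS !q_exp_dbl !exprS !expr0.
move: (q ^+ d) (q ^+ i) => Y Z si qnd Y0 Z0.
have si' : t * (q * Z) * (t * (q * Z)) - 1 != 0.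
  apply: contraNneq si => H; rewrite (_ : _ - _ = (t * (q * Z) * (t * (q * Z)) - 1) / (t * (q * Z))).
    by rewrite H mul0r.
  by field; rewrite ?q0 ?t0 ?Z0.
have qnd' : Y * Y - 1 != 0.
  apply: contraNneq qnd => H; rewrite (_ : _ - _ = (Y * Y - 1) / Y).
    by rewrite H mul0r.
  by field.
by field; rewrite q0 s0 Z0 Y0 t0 qnd' si' oner_neq0.
Qed.
End Recurrence.
End SplitForm.

(** * Modules of a self-adjoint matrix algebra *)

Section Orth.
Local Open Scope sesquilinear_scope.
Variable C : numClosedFieldType.

Lemma trmxC_mul m n p (X : 'M[C]_(m, n)) (Y : 'M[C]_(n, p)) :
  (X *m Y) ^t* = Y ^t* *m X ^t*.
Proof. by rewrite trmx_mul map_mxM. Qed.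

Lemma trmxC_trace_eq0 m n (X : 'M[C]_(m, n)) :
  \tr (X *m X ^t*) = 0 -> X = 0.
Proof.
move=> h; apply/matrixP => i j; rewrite mxE; apply/eqP.
have pos i' j' : 0 <= X i' j' * (X ^t*) j' i' by rewrite !mxE mul_conjC_ge0.
have pos' i' : 0 <= (X *m X ^t*) i' i' by rewrite mxE sumr_ge0.
move: (psumr_eq0P (fun i _ => pos' i) h (i := i) isT); rewrite mxE => h2.
by have /eqP := psumr_eq0P (fun j _ => pos i j) h2 (i := j) isT; rewrite !mxE mul_conjC_eq0.
Qed.

Lemma mulmx_trmxC_eq0 m n (X : 'M[C]_(m, n)) : X *m X ^t* = 0 -> X = 0.
Proof. by move=> h; apply: trmxC_trace_eq0; rewrite h mxtrace0. Qed.

Definition orth m n (U : 'M[C]_(m, n)) : 'M[C]_n := kermx (U ^t*).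

Lemma sub_orth m n p (U : 'M[C]_(m, n)) (V : 'M[C]_(p, n)) :
  (V <= orth U)%MS = (V *m U ^t* == 0).
Proof. exact: sub_kermx. Qed.

Lemma cap_orth n (U : 'M[C]_n) : (U :&: orth U)%MS = 0.
Proof.
apply/eqP; rewrite -submx0; apply/rV_subP => v; rewrite sub_capmx sub_orth.
move=> /andP[/submxP[x ->] /eqP h]; suff -> : x *m U = 0 by rewrite sub0mx.
by apply: mulmx_trmxC_eq0; rewrite trmxC_mul mulmxA h mul0mx.
Qed.

Lemma rank_orth n (U : 'M[C]_n) : \rank (orth U) = (n - \rank U)%N.
Proof. by rewrite mxrank_ker mxrank_map mxrank_tr. Qed.

Lemma adds_orth n (U : 'M[C]_n) : (1%:M <= U + orth U)%MS.
Proof.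
rewrite sub1mx /row_full mxrank_disjoint_sum ?cap_orth // rank_orth.
by rewrite subnKC ?rank_leq_row.
Qed.

(** Turns the predicate [inT] into a row space, so that an orthogonal projection onto T exists. A
    missing vector is adjoined until none is left, which the dimension bounds. *)
Lemma subspace_mx n (S : 'rV[C]_n -> Prop) :
  S 0 -> (forall c u v, S u -> S v -> S (c *: u + v)) ->
  exists U : 'M[C]_n, forall v, (v <= U)%MS <-> S v.
Proof.
move=> S0 Slin.
suff H k (U : 'M[C]_n) : (n - \rank U <= k)%N -> (forall v, (v <= U)%MS -> S v) ->
    exists U : 'M[C]_n, forall v, (v <= U)%MS <-> S v.
  by apply: (H n 0) => [|v]; rewrite ?leq_subr // submx0 => /eqP->.
elim: k U => [|k IH] U rU SU.
  exists U => v; split; first exact: SU.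
  move=> _; apply: submx_full; rewrite -col_leq_rank.
  by move: rU; rewrite leqn0 subn_eq0.
case: (pselect (exists v, S v /\ ~~ (v <= U)%MS)) => [[v [Sv vU]]|nex]; last first.
  exists U => v; split; first exact: SU.
  by move=> Sv; apply: contraPT Sv => vU Sv; apply: nex; exists v.
apply: (IH (U + v)%MS).
  have : (\rank U < \rank (U + v)%MS)%N.
    have := ltmxErank U (U + v)%MS; rewrite addsmxSl /= => <-.
    by rewrite /ltmx addsmxSl addsmx_sub submx_refl.
  by move: rU; have := rank_leq_row (U + v)%MS; lia.
move=> w /sub_addsmxP[[w1 w2] /= ->].
rewrite (mx11_scalar w2) mul_scalar_mx addrC; apply: Slin => //.
by apply: SU; apply: submxMl.
Qed.
End Orth.

(** * Complete reducibility, scalar actions and Schur's lemma for T *)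

Section Algebra.
Local Open Scope sesquilinear_scope.
Variables (C : numClosedFieldType) (n : nat) (A As : 'M[C]_n).
Hypotheses (hermA : A ^t* = A) (hermAs : As ^t* = As).

Local Notation inT := (inT A As).
Local Notation irreducible := (irreducible A As).
Local Notation Tmodule := (Tmodule A As).

Lemma inT_adj M : inT M -> inT (M ^t*).
Proof.
elim=> [|||M1 M2 _ h1 _ h2|c M1 _ h1|M1 M2 _ h1 _ h2].
- by rewrite trmx1 map_mx1; apply: inT1.
- by rewrite hermA; apply: inTA.
- by rewrite hermAs; apply: inTAs.
- by rewrite linearD /= map_mxD; apply: inTadd.
- by rewrite linearZ /= map_mxZ; apply: inTscale.
- by rewrite trmxC_mul; apply: inTmul.
Qed.

Lemma inT0 : inT 0.
Proof. by rewrite -(scale0r 1%:M); apply/inTscale/inT1. Qed.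

Lemma inT_sub M N : inT M -> inT N -> inT (M - N).
Proof. by move=> hM hN; rewrite -scaleN1r; apply/inTadd/inTscale. Qed.

Lemma Tmodule_gen W : (W *m A^T <= W)%MS -> (W *m As^T <= W)%MS -> Tmodule W.
Proof.
move=> hA hAs M; elim=> [|||M1 M2 _ h1 _ h2|c M1 _ h1|M1 M2 _ h1 _ h2] //.
- by rewrite trmx1 mulmx1.
- by rewrite linearD /= mulmxDr addmx_sub.
- by rewrite linearZ /= -scalemxAr scalemx_sub.
- rewrite trmx_mul mulmxA; exact: submx_trans (submxMr _ h2) h1.
Qed.

(** T is closed under adjoints, so stability of a subspace passes to its Hermitian complement. *)
Lemma Tmodule_orth W : Tmodule W -> Tmodule (orth W).
Proof.
move=> hW M hM; have /submxP[X e] := hW _ (inT_adj hM); rewrite sub_orth -mulmxA.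
have -> : M^T = ((M ^t*)^T) ^t* by apply/matrixP => i j; rewrite !mxE conjCK.
rewrite -trmxC_mul e trmxC_mul.
by rewrite mulmxA (sub_kermxP (submx_refl _)) mul0mx.
Qed.

Lemma irreducible_sub W : Tmodule W -> \rank W != 0%N ->
  exists2 U, irreducible U & (U <= W)%MS.
Proof.
have [k] := ubnP (\rank W); elim: k W => // k IH W rW mW W0.
case: (pselect (irreducible W)) => [iW|niW]; first by exists W.
have [U [UW [mU [U0 UnW]]]] : exists U, (U <= W)%MS /\ Tmodule U /\
    \rank U != 0%N /\ ~~ (U == W)%MS.
  apply: contrapT => nex; apply: niW; split => // U UW mU.
  case: (eqVneq (\rank U) 0%N) => [->|U0]; first by left.
  by right; apply: contrapT => UnW; apply: nex; exists U; do !split => //; apply/negP.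
have ltUW : (\rank U < \rank W)%N by rewrite (ltn_leqif (mxrank_leqif_eq UW)).
have [|X iX XU] := IH U _ mU U0; first by rewrite (leq_trans ltUW) // -ltnS.
by exists X => //; apply: submx_trans XU UW.
Qed.

Lemma Tmodule_adds U W : Tmodule U -> Tmodule W -> Tmodule (U + W)%MS.
Proof. by move=> mU mW M hM; rewrite addsmxMr addsmxS ?mU ?mW. Qed.

(** Complete reducibility without choosing a decomposition: while a submodule [K] killed by [M^T] is
    not everything, its complement contains an irreducible module, also killed, that can be
    adjoined. *)
Lemma irreducible_ext0 (M : 'M[C]_n) : (forall W, irreducible W -> W *m M^T = 0) -> M = 0.
Proof.
move=> h.
suff [K fK KM] : exists2 K : 'M[C]_n, row_full K & K *m M^T = 0.
  have [Y YK] := row_fullP fK.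
  by apply: trmx_inj; rewrite trmx0 -[M^T]mul1mx -YK -mulmxA KM mulmx0.
suff H k (K : 'M[C]_n) : (n - \rank K <= k)%N -> Tmodule K -> K *m M^T = 0 ->
    exists2 K : 'M[C]_n, row_full K & K *m M^T = 0.
  apply: (H n 0); rewrite ?leq_subr ?mul0mx // => N _.
  by rewrite mul0mx sub0mx.
elim: k K => [|k IH] K rK mK KM.
  by exists K => //; rewrite -col_leq_rank -subn_eq0 -leqn0.
case: (boolP (\rank (orth K) == 0%N)) => [|K0].
  by rewrite rank_orth => /eqP r0; exists K => //; rewrite -col_leq_rank -subn_eq0 r0.
have [W iW WK] := irreducible_sub (Tmodule_orth mK) K0.
have [mW W0 _] := iW.
apply: (IH (K + W)%MS).
- rewrite mxrank_disjoint_sum.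
    by move: rK W0; have := rank_leq_row K; lia.
  by apply/eqP; rewrite -submx0 -(cap_orth K) capmxS.
- exact: Tmodule_adds.
- by apply/eqP; rewrite -submx0 addsmxMr KM (h _ iW) addsmx_sub sub0mx.
Qed.

Lemma acts_scalar_ext f M N : acts_as_scalar A As f M -> acts_as_scalar A As f N -> M = N.
Proof.
move=> hM hN; apply/eqP; rewrite -subr_eq0; apply/eqP/irreducible_ext0 => W iW.
by rewrite linearB /= mulmxBr hM // hN // subrr.
Qed.

Lemma acts_scalarD f g M N : acts_as_scalar A As f M -> acts_as_scalar A As g N ->
  acts_as_scalar A As (fun W => f W + g W) (M + N).
Proof. by move=> hM hN W iW; rewrite linearD /= mulmxDr hM // hN // scalerDl. Qed.

Lemma acts_scalarM f g M N : acts_as_scalar A As f M -> acts_as_scalar A As g N ->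
  acts_as_scalar A As (fun W => f W * g W) (M *m N).
Proof.
move=> hM hN W iW.
by rewrite trmx_mul mulmxA hN // -scalemxAl hM // scalerA mulrC.
Qed.

Lemma acts_scalarZ c f M : acts_as_scalar A As f M ->
  acts_as_scalar A As (fun W => c * f W) (c *: M).
Proof. by move=> hM W iW; rewrite linearZ /= -scalemxAr hM // scalerA. Qed.

Lemma acts_scalar_comm f M N : acts_as_scalar A As f M -> inT N -> M *m N = N *m M.
Proof.
move=> hM hN; apply/eqP; rewrite -subr_eq0; apply/eqP/irreducible_ext0 => W iW.
have [mW _ _] := iW; have /submxP[X e] := mW _ hN.
rewrite linearB /= mulmxBr !trmx_mul !mulmxA (hM _ iW) -scalemxAl e -mulmxA (hM _ iW).
by rewrite -scalemxAr subrr.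
Qed.

(** [M] commutes with T, so its kernel is a T-module; a nonzero kernel would contain an irreducible
    module on which [f] vanishes. *)
Lemma acts_scalar_unit f M : acts_as_scalar A As f M ->
  (forall W, irreducible W -> f W != 0) -> M \in unitmx.
Proof.
move=> hM f0; rewrite -unitmx_tr -row_free_unit -kermx_eq0 -mxrank_eq0.
apply/negPn/negP => r0.
have [|W iW WK] := irreducible_sub _ r0.
  move=> N hN; rewrite sub_kermx -mulmxA -trmx_mul (acts_scalar_comm hM hN) trmx_mul mulmxA.
  by rewrite (sub_kermxP (submx_refl _)) mul0mx.
move/sub_kermxP: WK; rewrite hM // => /eqP; rewrite scaler_eq0 (negPf (f0 _ iW)) /=.
by have [_ + _] := iW; rewrite -mxrank_eq0 => /negPf->.
Qed.

Lemma acts_scalar_inv f M : acts_as_scalar A As f M ->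
  (forall W, irreducible W -> f W != 0) ->
  acts_as_scalar A As (fun W => (f W)^-1) (invmx M).
Proof.
move=> hM f0 W iW; have uM := acts_scalar_unit hM f0.
rewrite -[W in LHS](scale1r) -(mulVf (f0 W iW)) -scalerA -hM // -scalemxAl -mulmxA.
by rewrite -trmx_mul mulVmx // trmx1 mulmx1.
Qed.

Definition centralizes (N : 'M[C]_n) := forall M, inT M -> N *m M = M *m N.

(** Schur's lemma: the kernel of [N^T] on [W] is a proper submodule, hence zero, and submodules of
    the image pull back to submodules of [W]. *)
Lemma irreducible_image W N : irreducible W -> centralizes N -> W *m N^T != 0 ->
  irreducible (W *m N^T) /\ Tiso A As W (W *m N^T).
Proof.
move=> [mW W0 minW] cN WN0.
have cNT M : inT M -> M^T *m N^T = N^T *m M^T by move=> hM; rewrite -!trmx_mul cN.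
have mK : Tmodule (W :&: kermx N^T)%MS.
  move=> M hM; rewrite sub_capmx (submx_trans (submxMr _ (capmxSl _ _))) ?mW //=.
  by rewrite sub_kermx -mulmxA cNT // mulmxA (sub_kermxP (capmxSr _ _)) mul0mx.
have inj : (W :&: kermx N^T)%MS == 0.
  rewrite -mxrank_eq0; case: (minW _ (capmxSl _ _) mK) => [->|/andP[_ h]] //.
  case/negP: WN0; apply/eqP/sub_kermxP.
  by apply: submx_trans h (capmxSr _ _).
have rWN : \rank (W *m N^T) = \rank W by apply/mxrank_injP.
split; last first.
  exists N; split => //; first by apply/eqmxP.
  by move=> M hM; rewrite -!mulmxA cNT.
split.
- by move=> M hM; rewrite -mulmxA -cNT // mulmxA submxMr ?mW.
- by rewrite rWN.
move=> U /submxP[X e] mU.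
have injr p (Y : 'M_(p, n)) : (Y <= W)%MS -> Y *m N^T = 0 -> Y = 0.
  move=> YW YN; apply/eqP; rewrite -submx0 -(eqP inj) sub_capmx YW.
  by apply/sub_kermxP.
(* [X *m W] is the preimage of [U]; its stability follows from that of [U] since [N^T] is injective
   on [W]. *)
have mXW : Tmodule (X *m W).
  move=> M hM; have /submxP[Y eY] := mU M hM.
  suff -> : X *m W *m M^T = Y *m (X *m W) by apply: submxMl.
  apply/eqP; rewrite -subr_eq0; apply/eqP; apply: injr.
    by rewrite addmx_sub ?eqmx_opp ?mulmxA ?submxMl // -mulmxA mulmx_sub ?mW.
  have -> : (X *m W *m M^T - Y *m (X *m W)) *m N^T
      = X *m (W *m N^T) *m M^T - Y *m (X *m (W *m N^T)).
    by rewrite mulmxBl -(mulmxA _ M^T) cNT // !mulmxA.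
  by rewrite -e eY subrr.
case: (minW _ (submxMl _ _) mXW) => [/eqP|/andP[_ h]].
  by rewrite mxrank_eq0 => /eqP r0; left; rewrite e mulmxA r0 mul0mx mxrank0.
right; apply/andP; split; first by rewrite e submxMl.
by rewrite e mulmxA submxMr.
Qed.

(** [N^T] either kills [W] or carries it to an isomorphic module, where [M] acts by the same
    scalar. *)
Lemma acts_scalar_bicomm f M N : acts_as_scalar A As f M ->
  (forall W1 W2, irreducible W1 -> irreducible W2 -> Tiso A As W1 W2 -> f W1 = f W2) ->
  centralizes N -> M *m N = N *m M.
Proof.
move=> hM finv cN; apply/eqP; rewrite -subr_eq0; apply/eqP/irreducible_ext0 => W iW.
rewrite linearB /= mulmxBr !trmx_mul !mulmxA (hM _ iW) -scalemxAl.
case: (eqVneq (W *m N^T) 0) => [->|WN]; first by rewrite mul0mx scaler0 subrr.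
have [iWN iso] := irreducible_image iW cN WN.
by rewrite hM // (finv _ _ iW iWN iso) subrr.
Qed.
End Algebra.

(** * The bicommutant theorem for T *)

Section Bicommutant.
Local Open Scope sesquilinear_scope.
Variables (C : numClosedFieldType) (n : nat) (A As : 'M[C]_n).
Hypotheses (hermA : A ^t* = A) (hermAs : As ^t* = As).

Local Notation inT := (inT A As).

Lemma mxvec_dot (X Y : 'M[C]_n) :
  mxvec X *m (mxvec Y) ^t* = (\tr (X *m Y ^t*))%:M.
Proof.
rewrite [LHS]mx11_scalar; congr (_%:M); rewrite mxE.
rewrite (reindex _ (curry_mxvec_bij n n)) /=.
transitivity (\sum_i \sum_j X i j * (Y i j)^*).
  rewrite (pair_bigA _ (fun i j => X i j * (Y i j)^*)) /=; apply: eq_bigr => -[i j] _ /=.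
  by rewrite !mxE /= !mxvecE.
apply: eq_bigr => i _; rewrite mxE; apply: eq_bigr => j _.
by rewrite !mxE.
Qed.

(* The Hermitian projection of the matrix space onto the algebra commutes with
   left multiplication by the algebra, so its matrix blocks centralize the
   algebra; hence it fixes M = M * 1. *)
Lemma bicommutant M : (forall N, centralizes A As N -> M *m N = N *m M) -> inT M.
Proof.
move=> cM.
have [|c u v Tu Tv|U UP] := @subspace_mx C (n * n) (fun v => inT (vec_mx v)).
- by rewrite linear0; apply: inT0.
- by rewrite linearP /=; apply/inTadd/Tv/inTscale.
have TU X : inT X <-> (mxvec X <= U)%MS by rewrite UP mxvecK.
have UoP X : (mxvec X <= orth U)%MS <-> forall Y, inT Y -> \tr (X *m Y ^t*) = 0.
  rewrite sub_orth; split=> [/eqP XU Y /TU/submxP[y ey] | h].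
    have := mxvec_dot X Y; rewrite ey trmxC_mul mulmxA XU mul0mx.
    by move=> /(congr1 (fun Z : 'M_1 => Z 0 0)); rewrite !mxE mulr1n.
  apply/eqP/rowP => k; rewrite [RHS]mxE.
  have /UP /h := row_sub k U.
  have := mxvec_dot X (vec_mx (row k U)); rewrite vec_mxK => e h0.
  move: e; rewrite h0 => /(congr1 (fun Z : 'M_1 => Z 0 0)); rewrite !mxE mul0rn => e0.
  by apply: etrans e0; apply: eq_bigr => j _; rewrite !mxE.
(* For the trace form, the adjoint of left multiplication by [N] is left multiplication by [N ^t*],
   which is again in T. *)
have Uo_stable N X : inT N -> (mxvec X <= orth U)%MS -> (mxvec (N *m X) <= orth U)%MS.
  move=> TN /UoP h; apply/UoP => Y TY.
  rewrite -mulmxA mxtrace_mulC -mulmxA.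
  by rewrite -[N]trmxCK -trmxC_mul h //; apply: inTmul => //; apply: inT_adj.
pose P := proj_mx U (orth U).
pose f X := vec_mx (mxvec X *m P) : 'M_n.
have f_id X : inT X -> f X = X.
  by move=> /TU h; rewrite /f proj_mx_id ?cap_orth // mxvecK.
have f_T X : inT (f X) by apply/UP; apply: proj_mx_sub.
have fD X Y : f (X + Y) = f X + f Y by rewrite /f linearD mulmxDl linearD.
have fZ c X : f (c *: X) = c *: f X by rewrite /f linearZ /= -scalemxAl linearZ.
have f0 : f 0 = 0 by rewrite /f linear0 mul0mx linear0.
have f_sum I (r : seq I) (Q : pred I) (X : I -> 'M_n) :
    f (\sum_(i <- r | Q i) X i) = \sum_(i <- r | Q i) f (X i).
  exact: (big_morph f fD f0).
have f_mul N X : inT N -> f (N *m X) = N *m f X.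
  move=> TN; have hX : (mxvec (X - f X) <= orth U)%MS.
    rewrite linearB /= vec_mxK; apply: proj_mx_compl_sub.
    exact: submx_trans (submx1 _) (adds_orth U).
  have -> : N *m X = N *m f X + N *m (X - f X) by rewrite -mulmxDr addrC subrK.
  rewrite fD f_id; last exact: inTmul.
  by rewrite {2}/f proj_mx_0 ?cap_orth ?Uo_stable // linear0 addr0.
(* Column [k] of [f X] is the sum over [j] of [Blk j k] applied to column [j] of [X]. Left
   multiplication acts on each column separately, which is why every block inherits the
   commutation. *)
pose Blk (j k : 'I_n) : 'M_n := \matrix_(i, l) f (delta_mx l j) i k.
have fE X i k : f X i k = \sum_j \sum_l Blk j k i l * X l j.
  rewrite {1}(matrix_sum_delta X) f_sum summxE exchange_big /=; apply: eq_bigr => j _.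
  rewrite f_sum summxE; apply: eq_bigr => l _.
  by rewrite fZ !mxE mulrC.
have Blk_c j k : centralizes A As (Blk j k).
  move=> N TN; apply/matrixP => i l.
  have := congr1 (fun Z : 'M_n => Z i k) (f_mul N (delta_mx l j) TN).
  rewrite fE [RHS]mxE [X in _ = X -> _](_ : _ = (N *m Blk j k) i l); last first.
    by rewrite mxE; apply: eq_bigr => p _; rewrite !mxE.
  move=> <-; rewrite (bigD1 j) //= [X in _ = _ + X]big1 ?addr0 => [|j' j'j]; last first.
    apply: big1 => l' _; rewrite [X in _ * X]mxE big1 ?mulr0 // => p _.
    by rewrite mxE (negPf j'j) andbF mulr0.
  rewrite mxE; apply: eq_bigr => p _; congr (_ * _).
  rewrite [RHS]mxE (bigD1 l) //= big1 ?addr0 => [|p' p'l]; first by rewrite mxE !eqxx mulr1.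
  by rewrite mxE (negPf p'l) mulr0.
suff -> : M = f M by apply: f_T.
have {1}-> : M = M *m f 1%:M by rewrite f_id ?mulmx1 //; apply: inT1.
apply/matrixP => i k; rewrite mxE.
transitivity (\sum_j (M *m Blk j k) i j).
  transitivity (\sum_j \sum_l M i l * Blk j k l j); last first.
    by apply: eq_bigr => j _; rewrite [RHS]mxE.
  rewrite exchange_big /=; apply: eq_bigr => l _.
  rewrite fE big_distrr /=; apply: eq_bigr => j _.
  rewrite (bigD1 j) //= big1 ?addr0 => [|p pj]; first by rewrite [1%:M _ _]mxE eqxx mulr1.
  by rewrite [1%:M _ _]mxE (negPf pj) mulr0.
rewrite fE; apply: eq_bigr => j _; rewrite (cM _ (Blk_c j k)) mxE.
by [].
Qed.

Lemma acts_scalar_inT f M : acts_as_scalar A As f M ->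
  (forall W1 W2, irreducible A As W1 -> irreducible A As W2 -> Tiso A As W1 W2 -> f W1 = f W2) ->
  inT M.
Proof.
move=> hM finv; apply: bicommutant => N cN.
exact: (acts_scalar_bicomm hermA hermAs hM finv cN).
Qed.

Lemma Tiso_rank W1 W2 M : Tmodule A As W1 -> Tiso A As W1 W2 -> inT M ->
  \rank (W1 *m M^T) = \rank (W2 *m M^T).
Proof.
move=> mW1 [P [/eqmxP e /mxrank_injP r cP]] hM.
transitivity (\rank (W1 *m P^T *m M^T)); last by rewrite (eqmxMr _ e).
rewrite -cP //; apply/esym/mxrank_injP; rewrite -submx0.
by apply: submx_trans (capmxS (mW1 _ hM) (submx_refl _)) _; rewrite submx0.
Qed.
End Bicommutant.

(** * The Bose-Mesner algebra *)

Section Distance.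
Variables (n : nat) (adj : rel 'I_n).
Hypotheses (sg : simple_graph adj) (conn : gconnected adj).

Lemma ballP x z k : reflect (z \in ball adj x k \/ exists2 y, y \in ball adj x k & adj y z)
  (z \in ball adj x k.+1).
Proof.
rewrite /= in_setU inE; apply: (iffP orP) => -[h|h]; [by left| |by left|]; right.
  by have /existsP[y /andP[]] := h; exists y.
by case: h => y yb yz; apply/existsP; exists y; rewrite yb.
Qed.

Lemma ball_leq x k l : (k <= l)%N -> {subset ball adj x k <= ball adj x l}.
Proof.
move=> /subnK <- y yk; elim: (l - k)%N => [|m IH] //.
by rewrite addSn; apply/ballP; left.
Qed.

Lemma ball_cat x y z k l :
  y \in ball adj x k -> z \in ball adj y l -> z \in ball adj x (k + l).
Proof.
move=> yk; elim: l z => [|l IH] z; first by rewrite /= inE addn0 => /eqP->.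
move/ballP => [/IH h|[w /IH h wz]]; rewrite addnS; apply/ballP; first by left.
by right; exists w.
Qed.

Lemma ball_sym x y k : y \in ball adj x k -> x \in ball adj y k.
Proof.
elim: k y => [|k IH] y; first by rewrite /= !inE eq_sym.
move/ballP => [/IH h|[w /IH h wy]]; first by apply/ballP; left.
rewrite -add1n; apply: ball_cat h; apply/ballP; right; exists y; first by rewrite inE.
by rewrite sg.1.
Qed.

(** A ball that fails to grow once never grows again, so it gains a vertex at each step until it is
    everything. Hence the search range in [gdist] is long enough. *)
Lemma ball_full x : ball adj x n.-1 = setT.
Proof.
have n0 : (0 < n)%N := leq_ltn_trans (leq0n _) (ltn_ord x).
have stab k l : ball adj x k.+1 = ball adj x k -> ball adj x (k + l) = ball adj x k.
  by move=> e; elim: l => [|l IH]; rewrite ?addn0 // addnS /= IH.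
have full k : ball adj x k.+1 = ball adj x k -> ball adj x k = setT.
  move=> e; apply/setP => y; rewrite in_setT; have [m ym] := conn x y.
  by rewrite -(stab _ m e) addnC; apply: ball_leq ym; rewrite leq_addr.
have grow k : (k < #|ball adj x k|)%N \/ ball adj x k = setT.
  elim: k => [|k [IH|IH]]; first by left; rewrite cards1.
    case: (eqVneq (ball adj x k.+1) (ball adj x k)) => [e|ne]; first by right; rewrite e full.
    left; apply: leq_ltn_trans IH _; apply: proper_card; rewrite properEneq eq_sym ne.
    by apply/subsetP/ball_leq.
  by right; apply/setP => y; rewrite in_setT; apply: (ball_leq (leqnSn k)); rewrite IH in_setT.
case: (grow n.-1) => // h; apply/eqP; rewrite eqEcard subsetT cardsT card_ord.
by apply: leq_trans h; rewrite prednK.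
Qed.

Lemma gdist_lt x y : (gdist adj x y < n)%N.
Proof.
have n0 : (0 < n)%N := leq_ltn_trans (leq0n _) (ltn_ord x).
rewrite /gdist -[X in (_ < X)%N](size_iota 0 n) -has_find.
by apply/hasP; exists n.-1; rewrite ?ball_full ?inE // mem_iota /= add0n prednK.
Qed.

Lemma gdist_ball x y : y \in ball adj x (gdist adj x y).
Proof.
have lt := gdist_lt x y.
have : has (fun k => y \in ball adj x k) (iota 0 n) by rewrite has_find size_iota.
by move=> /(nth_find 0); rewrite nth_iota.
Qed.

Lemma gdist_leP x y k : (gdist adj x y <= k)%N = (y \in ball adj x k).
Proof.
apply/idP/idP => [le|yk]; first exact: ball_leq le _ (gdist_ball x y).
rewrite leqNgt; apply/negP => lt; have := before_find 0 lt.
by rewrite nth_iota ?yk //; apply: ltn_trans (gdist_lt x y).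
Qed.

Lemma gdist_sym x y : gdist adj x y = gdist adj y x.
Proof.
by apply/eqP; rewrite eqn_leq; apply/andP; split; rewrite gdist_leP;
  apply: ball_sym; apply: gdist_ball.
Qed.

Lemma gdist_eq0 x y : (gdist adj x y == 0%N) = (x == y).
Proof. by rewrite -leqn0 gdist_leP /= inE eq_sym. Qed.

Lemma gdist_adj x y z : adj y z -> (gdist adj x z <= (gdist adj x y).+1)%N.
Proof.
by move=> yz; rewrite gdist_leP; apply/ballP; right; exists y => //; apply: gdist_ball.
Qed.

Lemma gdist_pred x y k : gdist adj x y = k.+1 ->
  exists2 z, gdist adj x z = k & adj z y.
Proof.
move=> e; have := gdist_ball x y; rewrite e => /ballP[|[z zk zy]].
  by rewrite -gdist_leP e ltnn.
exists z => //; apply/eqP; rewrite eqn_leq gdist_leP zk /=.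
by have := gdist_adj x zy; rewrite e ltnS.
Qed.

Lemma gdist_leq x y k : (k <= gdist adj x y)%N -> exists z, gdist adj x z = k.
Proof.
have [m e] : exists m, gdist adj x y = m by eexists.
rewrite e; elim: m y e => [|m IH] y e; first by rewrite leqn0 => /eqP->; exists y.
rewrite leq_eqVlt ltnS => /orP[/eqP->|]; first by exists y.
by have [z ez _] := gdist_pred e; apply: IH ez.
Qed.

Lemma gdist_le_diam x y : (gdist adj x y <= diam adj)%N.
Proof.
apply: leq_trans (@leq_bigmax _ (fun x => \max_(y < n) gdist adj x y) x).
exact: (@leq_bigmax _ (fun y => gdist adj x y)).
Qed.

Lemma diam_attained (x0 : 'I_n) : exists x y, gdist adj x y = diam adj.
Proof.
have c0 : (0 < #|'I_n|)%N by apply/card_gt0P; exists x0.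
have [x ex] := @bigop.eq_bigmax _ (fun x => \max_(y < n) gdist adj x y) c0.
have [y ey] := @bigop.eq_bigmax _ (fun y => gdist adj x y) c0.
by exists x, y; rewrite -ey -ex.
Qed.

(** Distance-regularity, applied to the pairs (x', x') and (x, x), makes the sizes of spheres
    independent of the centre. *)
Lemma gdist_attained : distance_regular adj -> forall x k, (k <= diam adj)%N ->
  exists y, gdist adj x y = k.
Proof.
move=> dr x k kD; have [x' [y' e']] := diam_attained x.
rewrite -e' in kD; have [z ez] := gdist_leq kD.
have g0 t : gdist adj t t = 0%N by apply/eqP; rewrite gdist_eq0.
have /(dr x' x' x x) /(_ k k) : gdist adj x' x' = gdist adj x x by rewrite !g0.
have : (0 < #|[set z | (gdist adj x' z == k) && (gdist adj x' z == k)]|)%N.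
  by apply/card_gt0P; exists z; rewrite inE ez eqxx.
by move=> /[swap] -> /card_gt0P[y]; rewrite inE => /andP[/eqP]; exists y.
Qed.
End Distance.

(** * Idempotents as polynomials in a diagonalisable matrix *)

Section PolyProd.
Variables (C : fieldType) (n : nat) (X : 'M[C]_n).

Definition polyprod (s : seq C) : 'M[C]_n :=
  foldr (fun c M => M *m (X - c%:M)) 1%:M s.

Lemma eigen_polyprod m (v : 'M[C]_(m, n)) c s : v *m X = c *: v ->
  v *m polyprod s = (\prod_(e <- s) (c - e)) *: v.
Proof.
move=> e; elim: s => [|d s IH]; first by rewrite big_nil scale1r mulmx1.
rewrite big_cons /= mulmxA IH -scalemxAl mulmxBr e mul_mx_scalar -scalerBl scalerA.
by rewrite mulrC.
Qed.

Variables (D : nat) (P : nat -> 'M[C]_n) (c : nat -> C).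
Hypothesis PX : forall i, (i <= D)%N -> P i *m X = c i *: P i.
Hypothesis P1 : \sum_(i < D.+1) P i = 1%:M.
Hypothesis c_inj : forall i j, (i <= D)%N -> (j <= D)%N -> c i = c j -> i = j.

(** Lagrange interpolation. It serves to place the [E i] and the [Estar i] in T. *)
Lemma idem_polyprod i : (i <= D)%N ->
  exists s (k : C), P i = k *: polyprod s.
Proof.
move=> iD; pose s := [seq c l | l <- iota 0 D.+1 & l != i].
have h0 : \prod_(e <- s) (c i - e) != 0.
  rewrite prodf_seq_neq0; apply/allP => e /mapP[l]; rewrite mem_filter mem_iota => /andP[li lD] ->.
  by rewrite /= subr_eq0; apply: contraNneq li => /c_inj -> //; lia.
exists s, (\prod_(e <- s) (c i - e))^-1.
rewrite -[polyprod s]mul1mx -P1 mulmx_suml (bigD1 (inord i)) //= [X in _ + X]big1 => [|j ji].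
  by rewrite inordK // (eigen_polyprod _ (PX iD)) addr0 scalerA mulVf ?scale1r.
rewrite (eigen_polyprod _ (PX (ltn_ord j : (j <= D)%N))).
suff /eqP-> : \prod_(e <- s) (c j - e) == 0 by rewrite scale0r.
rewrite prodf_seq_eq0; apply/hasP; exists (c j); rewrite ?subrr //=.
apply/mapP; exists (j : nat) => //; rewrite mem_filter mem_iota /= add0n ltn_ord andbT.
by apply: contraNneq ji => e; apply/eqP/val_inj; rewrite /= inordK.
Qed.
End PolyProd.

(** * Primitive idempotents, distinct eigenvalues and the tridiagonal relations *)

Section BoseMesner.
Local Open Scope sesquilinear_scope.
Variables (C : numClosedFieldType) (n : nat) (adj : rel 'I_n) (D : nat).
Hypotheses (sg : simple_graph adj) (conn : gconnected adj) (DE : D = diam adj).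
Variables (E : nat -> 'M[C]_n).
Hypothesis E_prim : forall i, (i <= D)%N -> prim_idem adj (E i).
Hypothesis E_inj : forall i j, (i <= D)%N -> (j <= D)%N -> E i = E j -> i = j.

Local Notation distmx := (distmx C adj).
Local Notation inBM := (@inBM C n adj).

Lemma distmx_sym i : (distmx i)^T = distmx i.
Proof. by apply/matrixP => y z; rewrite !mxE gdist_sym. Qed.

Lemma inBM_sym M : inBM M -> M^T = M.
Proof.
move=> [c ->]; rewrite linear_sum /=; apply: eq_bigr => i _.
by rewrite linearZ /= distmx_sym.
Qed.

Lemma inBM_entry M : inBM M <-> exists c : nat -> C, forall y z, M y z = c (gdist adj y z).
Proof.
have E' (c : nat -> C) y z : (\sum_(i < (diam adj).+1) c i *: distmx i) y z = c (gdist adj y z).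
  have lt : (gdist adj y z < (diam adj).+1)%N by rewrite ltnS gdist_le_diam.
  rewrite summxE (bigD1 (Ordinal lt)) //= big1 => [|i ni].
    by rewrite !mxE eqxx mulr1 addr0.
  rewrite !mxE; case: eqP => [e|]; rewrite ?mulr0 //.
  by case/negP: ni; apply/eqP/val_inj.
split=> [[c ->]|[c e]]; first by exists c.
by exists c; apply/matrixP => y z; rewrite e E'.
Qed.

Lemma inBM1 : inBM 1%:M.
Proof.
apply/inBM_entry; exists (fun k => (k == 0%N)%:R) => y z.
by rewrite mxE gdist_eq0.
Qed.

Lemma inBM_hada M N : inBM M -> inBM N -> inBM (hada M N).
Proof.
move=> /inBM_entry[c cE] /inBM_entry[d dE]; apply/inBM_entry; exists (fun k => c k * d k) => y z.
by rewrite mxE cE dE.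
Qed.

Lemma inBM_distmx k : inBM (distmx k).
Proof. by apply/inBM_entry; exists (fun i => (i == k)%:R) => y z; rewrite mxE. Qed.

Lemma E_BM i : (i <= D)%N -> inBM (E i).
Proof. by move=> /E_prim[]. Qed.

Lemma E_sym i : (i <= D)%N -> (E i)^T = E i.
Proof. by move=> /E_BM/inBM_sym. Qed.

Lemma E_neq0 i : (i <= D)%N -> E i != 0.
Proof. by move=> /E_prim[]. Qed.

Lemma E_idem i : (i <= D)%N -> E i *m E i = E i.
Proof. by move=> /E_prim[]. Qed.

(** Primitivity, used for both factors, allows only [E j] or 0 for [E i *m E j] and only [E i] or 0
    for [E j *m E i]. These products are transposes of each other, so if both were nonzero,
    [E i = E j] would follow. *)
Lemma E_orth i j : (i <= D)%N -> (j <= D)%N -> i != j -> E i *m E j = 0.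
Proof.
move=> iD jD ij.
have [_ _ _ /(_ _ (E_BM iD) (E_idem iD)) hj] := E_prim jD.
have [_ _ _ /(_ _ (E_BM jD) (E_idem jD)) hi] := E_prim iD.
have eT : E j *m E i = (E i *m E j)^T by rewrite trmx_mul !E_sym.
case: hj => [ej|//]; case: hi => [ei|e0]; last first.
  by apply: trmx_inj; rewrite -eT e0 trmx0.
have : E i = E j by rewrite -ei eT ej E_sym.
by move=> /(E_inj iD jD) e; rewrite e eqxx in ij.
Qed.

(** The D+1 idempotents are independent, being nonzero and orthogonal, in a space spanned by D+1
    distance matrices. So their coordinate matrix [S] is invertible. *)
Lemma BM_decomp M : inBM M -> exists m : nat -> C, M = \sum_(i < D.+1) m i *: E i.
Proof.
have /boolp.choice[Q hQ] (i : 'I_D.+1) : exists c : nat -> C,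
    E i = \sum_(k < D.+1) c k *: distmx k.
  by have [c ->] := E_BM (ltn_ord i : (i <= D)%N); exists c; rewrite DE.
pose S : 'M[C]_D.+1 := \matrix_(i, k) Q i k.
have frS : S \in unitmx.
  rewrite -row_free_unit -kermx_eq0; apply/rowV0P => v /sub_kermxP vS.
  have sum0 : \sum_(i < D.+1) v 0 i *: E i = 0.
    rewrite (eq_bigr (fun i : 'I_D.+1 => \sum_(k < D.+1) (v 0 i * S i k) *: distmx k)) => [|i _].
      rewrite exchange_big big1 //= => k _; rewrite -scaler_suml.
      have := congr1 (fun w : 'rV_D.+1 => w 0 k) vS; rewrite !mxE => ->.
      by rewrite scale0r.
    rewrite [E i]hQ scaler_sumr; apply: eq_bigr => k _.
    by rewrite scalerA /S mxE.
  apply/rowP => j; rewrite mxE.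
  have /eqP := congr1 (fun M => M *m E j) sum0.
  rewrite mulmx_suml mul0mx (bigD1 j) //= big1 => [|i ij].
    rewrite -scalemxAl E_idem -1?ltnS // addr0 scaler_eq0 (negPf (E_neq0 _)) -1?ltnS //.
    by rewrite orbF => /eqP.
  by rewrite -scalemxAl E_orth -1?ltnS // ?scaler0.
move=> [c ->]; exists (fun i => \sum_(k < D.+1) c k * invmx S k (inord i)).
have dE (k : 'I_D.+1) : distmx k = \sum_(i < D.+1) invmx S k i *: E i.
  rewrite (eq_bigr (fun i : 'I_D.+1 => \sum_(l < D.+1) (invmx S k i * S i l) *: distmx l)) => [|i _].
    rewrite exchange_big (bigD1 k) //= [X in _ + X]big1 => [|l lk].
      rewrite addr0 -scaler_suml; have := congr1 (fun M : 'M_D.+1 => M k k) (mulVmx frS).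
      by rewrite !mxE eqxx => ->; rewrite scale1r.
    rewrite -scaler_suml; have := congr1 (fun M : 'M_D.+1 => M k l) (mulVmx frS).
    by rewrite !mxE eq_sym (negPf lk) => ->; rewrite scale0r.
  rewrite [E i]hQ scaler_sumr; apply: eq_bigr => l _.
  by rewrite scalerA /S mxE.
rewrite -DE; under eq_bigr => k _ do rewrite dE scaler_sumr.
rewrite exchange_big; apply: eq_bigr => i _ /=; rewrite inord_val scaler_suml.
by apply: eq_bigr => k _; rewrite scalerA.
Qed.

Lemma sum_E_mul (m : nat -> C) j : (j <= D)%N -> (\sum_(i < D.+1) m i *: E i) *m E j = m j *: E j.
Proof.
move=> jD; rewrite mulmx_suml (bigD1 (Ordinal (jD : j < D.+1)%N)) //= big1 => [|i ij].
  by rewrite -scalemxAl E_idem // addr0.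
rewrite -scalemxAl E_orth ?scaler0 // -1?ltnS //.
Qed.

Lemma sum_E : \sum_(i < D.+1) E i = 1%:M.
Proof.
have [m e] := BM_decomp inBM1; rewrite e; apply: eq_bigr => i _.
have iD : (i <= D)%N by rewrite -ltnS.
by have := sum_E_mul m iD; rewrite -e mul1mx.
Qed.

Local Notation A := (adjmx C adj).

Lemma adjmx_sym : A^T = A.
Proof. by apply/matrixP => y z; rewrite !mxE sg.1. Qed.

Lemma adjmx_herm : A ^t* = A.
Proof. by rewrite adjmx_sym; apply/matrixP => y z; rewrite !mxE conjC_nat. Qed.

(** The product is a monic polynomial of degree [size s] in [A]; at that distance its entry counts
    shortest paths. *)
Lemma polyprod_adj_entry (s : seq C) y z :
  ((size s < gdist adj y z)%N -> polyprod A s y z = 0) /\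
  (gdist adj y z = size s -> 0 < polyprod A s y z).
Proof.
elim: s y z => [|c s IH] y z /=.
  rewrite mxE; split=> [|/eqP]; first by rewrite lt0n (gdist_eq0 conn) => /negPf->.
  by rewrite (gdist_eq0 conn) => ->; rewrite ltr01.
have t0 t : (size s < gdist adj y z)%N -> 0 <= polyprod A s y t * A t z.
  move=> lt; rewrite mxE; case: (boolP (adj t z)) => tz; last by rewrite mulr0.
  rewrite mulr1; have /leq_trans := lt => /(_ _ (gdist_adj conn y tz)).
  rewrite ltnS leq_eqVlt => /orP[/eqP/esym/(IH y t).2/ltW//|/(IH y t).1 ->//].
have e : (size s < gdist adj y z)%N ->
    (polyprod A s *m (A - c%:M)) y z = \sum_t polyprod A s y t * A t z.
  move=> lt; rewrite mulmxBr mul_mx_scalar !mxE (IH y z).1 // mulr0 subr0.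
  by apply: eq_bigr.
split=> [lt|ez].
  rewrite e; last exact: ltn_trans lt.
  apply: big1 => t _; rewrite [A _ _]mxE; case: (boolP (adj t z)) => tz; last by rewrite mulr0.
  by rewrite (IH y t).1 ?mul0r //; have := gdist_adj conn y tz; lia.
have lt : (size s < gdist adj y z)%N by rewrite ez.
rewrite e //; have [t yt tz] := gdist_pred conn ez.
rewrite (bigD1 t) //= ltr_pwDl //; last by apply: sumr_ge0 => *; apply: t0.
by rewrite [A _ _]mxE tz mulr1 (IH y t).2.
Qed.

Variable th : nat -> C.
Hypothesis A_decomp : A = \sum_(i < D.+1) th i *: E i.

Lemma E_A i : (i <= D)%N -> E i *m A = th i *: E i.
Proof.
move=> iD; apply: trmx_inj; rewrite trmx_mul adjmx_sym linearZ /= E_sym //.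
by rewrite A_decomp sum_E_mul.
Qed.

(** If two eigenvalues coincided, the D factors left after dropping one of them would still
    annihilate everything, yet their product has a positive entry at a pair of vertices at distance
    D. *)
Lemma th_inj (x0 : 'I_n) i j : (i <= D)%N -> (j <= D)%N -> th i = th j -> i = j.
Proof.
suff H i' j' : (i' < j' <= D)%N -> th i' <> th j'.
  move=> iD jD e; case: (ltngtP i j) => // lt; first by case: (H i j); rewrite ?lt.
  by case: (H j i); rewrite ?lt.
move: i' j' => {i j} i j /andP[ij jD] e.
pose s := [seq th l | l <- iota 0 D.+1 & l != j].
have sE : size s = D.
  rewrite size_map size_filter; have := count_predC (pred1 j) (iota 0 D.+1).
  rewrite size_iota (count_uniq_mem _ (iota_uniq _ _)) mem_iota /= add0n ltnS jD /=.
  by rewrite add1n => -[].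
have s_mem l : (l <= D)%N -> th l \in s.
  move=> lD; case: (eqVneq l j) => [->|lj].
    rewrite -e; apply/mapP; exists i => //; rewrite mem_filter mem_iota; lia.
  by apply/mapP; exists l => //; rewrite mem_filter lj mem_iota.
have p0 : polyprod A s = 0.
  rewrite -[LHS]mul1mx -sum_E mulmx_suml big1 // => l _.
  have lD : (l <= D)%N by rewrite -ltnS.
  rewrite (eigen_polyprod _ (E_A lD)).
  suff /eqP-> : \prod_(e <- s) (th l - e) == 0 by rewrite scale0r.
  by rewrite prodf_seq_eq0; apply/hasP; exists (th l); rewrite ?subrr ?s_mem /=.
have [y [z yz]] := diam_attained adj x0.
have := (polyprod_adj_entry s y z).2; rewrite sE DE yz => /(_ erefl).
by rewrite p0 mxE ltxx.
Qed.
Variable x : 'I_n.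

Lemma th_real i : (i <= D)%N -> (th i)^* = th i.
Proof.
move=> iD; have e : E i *m A *m (E i) ^t* = th i *: (E i *m (E i) ^t*).
  by rewrite E_A // scalemxAl.
have := congr1 (fun M : 'M_n => M ^t*) e.
rewrite /= !trmxC_mul adjmx_herm !trmxCK mulmxA e linearZ /= map_mxZ trmxC_mul trmxCK.
move=> /eqP; rewrite -subr_eq0 -scalerBl scaler_eq0 subr_eq0 => /orP[/eqP/esym//|/eqP h].
by have := E_neq0 iD; rewrite (mulmx_trmxC_eq0 h) eqxx.
Qed.

(** Symmetry of [E i] over the complex numbers is not enough. Its adjoint [F] satisfies A F = th_i
    F, so the other idempotents kill it and F = E_i F; the right-hand side is self-adjoint. *)
Lemma E_herm i : (i <= D)%N -> (E i) ^t* = E i.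
Proof.
move=> iD; set F := (E i) ^t*.
have FA : A *m F = th i *: F.
  rewrite -{1}adjmx_herm -trmxC_mul E_A // linearZ /= map_mxZ.
  by congr (_ *: _); apply: th_real.
have FE : F = E i *m F.
  rewrite -[LHS]mul1mx -sum_E mulmx_suml (bigD1 (Ordinal (iD : i < D.+1)%N)) //= big1 ?addr0 // => j ji.
  have jD : (j <= D)%N by rewrite -ltnS.
  have : E j *m A *m F = th j *: (E j *m F) by rewrite E_A // scalemxAl.
  rewrite -mulmxA FA -scalemxAr => /eqP.
  rewrite -subr_eq0 -scalerBl scaler_eq0 subr_eq0 => /orP[/eqP|/eqP//].
  by move=> /(th_inj x iD jD) e; case/negP: ji; apply/eqP/val_inj.
have := congr1 (fun M : 'M_n => M ^t*) FE.
by rewrite /= trmxC_mul /F trmxCK -/F -FE => <-.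
Qed.

Lemma E_trace i : (i <= D)%N -> \tr (E i) != 0.
Proof.
move=> iD; apply: contraTneq (E_neq0 iD) => t0.
by rewrite negbK; apply/eqP/trmxC_trace_eq0; rewrite E_herm // E_idem.
Qed.

Lemma inT_E (As : 'M[C]_n) i : (i <= D)%N -> inT A As (E i).
Proof.
move=> iD; have [s [k ->]] := idem_polyprod E_A sum_E (@th_inj x) iD.
apply: inTscale; elim: s => [|c s IH] /=; first exact: inT1.
apply: inTmul => //; apply: inT_sub; first exact: inTA.
by rewrite -scalemx1; apply/inTscale/inT1.
Qed.

Local Notation As := (Astarmx (E 1) x).
Local Notation Es := (Estar C adj x).
Variable ths : nat -> C.
Hypotheses (dr : distance_regular adj) (D0 : (0 < D)%N).
Hypothesis E0 : E 0%N = (n%:R)^-1 *: const_mx 1.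
Hypothesis Qp : Qpolynomial E D.
Hypothesis As_decomp : As = \sum_(i < D.+1) ths i *: Es i.

Lemma Es_sym i : (Es i)^T = Es i.
Proof. by apply/matrixP => y z; rewrite !mxE eq_sym; case: eqP => // ->. Qed.

Lemma Es_mul i j : Es i *m Es j = if i == j then Es i else 0.
Proof.
apply/matrixP => y z; rewrite mxE (bigD1 y) //= big1 => [|t ty].
  rewrite !mxE eqxx /= addr0; case: (eqVneq i j) => [<-|ij].
    by rewrite !mxE; case: eqP; case: eqP; rewrite ?mulr1 ?mulr0.
  rewrite mxE; case: (eqVneq (gdist adj x y) i) => [->|]; rewrite ?mul0r //.
  by rewrite (negPf ij) andbF mulr0.
by rewrite !mxE eq_sym (negPf ty) mul0r.
Qed.

Lemma sum_Es : \sum_(i < D.+1) Es i = 1%:M.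
Proof.
apply/matrixP => y z; rewrite summxE mxE.
have lt : (gdist adj x y < D.+1)%N by rewrite DE ltnS gdist_le_diam.
rewrite (bigD1 (Ordinal lt)) //= big1 => [|i ni]; first by rewrite mxE eqxx andbT addr0.
rewrite mxE; case: eqP => //= _; case: eqP => // e.
by case/negP: ni; apply/eqP/val_inj.
Qed.

Lemma Es_As i : (i <= D)%N -> Es i *m As = ths i *: Es i.
Proof.
move=> iD; rewrite As_decomp mulmx_sumr (bigD1 (Ordinal (iD : i < D.+1)%N)) //= big1 => [|j ji].
  by rewrite -scalemxAr Es_mul eqxx addr0.
by rewrite -scalemxAr Es_mul; case: eqP => [e|]; rewrite ?scaler0 //;
  case/negP: ji; apply/eqP/val_inj.
Qed.

Lemma As_sym : As^T = As.
Proof. by apply/matrixP => y z; rewrite !mxE eq_sym; case: eqP => [->|]; rewrite ?mul0r. Qed.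

Lemma E1_conj y z : (E 1 y z)^* = E 1 y z.
Proof.
have e : E 1 z y = E 1 y z by rewrite -[in LHS](E_sym D0) mxE.
by rewrite -[in RHS](E_herm D0) !mxE e.
Qed.

Lemma As_herm : As ^t* = As.
Proof.
rewrite As_sym; apply/matrixP => y z; rewrite !mxE !rmorphM /= E1_conj !conjC_nat.
by [].
Qed.

Lemma E1_entry y : n%:R * E 1 x y = ths (gdist adj x y).
Proof.
have lt : (gdist adj x y < D.+1)%N by rewrite DE ltnS gdist_le_diam.
have := congr1 (fun M : 'M_n => M y y) As_decomp; rewrite mxE eqxx mul1r => ->.
rewrite summxE (bigD1 (Ordinal lt)) //= big1 => [|i ni].
  by rewrite !mxE !eqxx mulr1 addr0.
rewrite !mxE eqxx /=; case: eqP => [e|]; rewrite ?mulr0 //.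
by case/negP: ni; apply/eqP/val_inj.
Qed.

Lemma n_neq0 : n%:R != 0 :> C.
Proof. by rewrite pnatr_eq0 -lt0n; apply: leq_ltn_trans (ltn_ord x). Qed.

(** A coincidence makes row [x] of [E 1] agree at vertices [y], [z] at distances [i], [j] from [x].
    The Krein conditions express E_(h+1) through E_1 o E_h and earlier idempotents, so all [E h]
    agree there, and with them every distance matrix. *)
Lemma ths_inj i j : (i <= D)%N -> (j <= D)%N -> ths i = ths j -> i = j.
Proof.
move=> iD jD e.
have [y yi] := gdist_attained conn dr x (leq_trans iD (eq_leq DE)).
have [z zj] := gdist_attained conn dr x (leq_trans jD (eq_leq DE)).
have e1 : E 1 x y = E 1 x z by apply: (mulfI n_neq0); rewrite !E1_entry yi zj.
have EE h : (h <= D)%N -> E h x y = E h x z.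
  have [k] := ubnP h; elim: k h => // k IH [|h] hk hD; first by rewrite E0 !mxE.
  have hD' : (h <= D)%N := ltnW hD.
  have [m mE] := BM_decomp (inBM_hada (E_BM D0) (E_BM hD')).
  have mE' l : (l <= D)%N -> hada (E 1) (E h) *m E l = m l *: E l.
    by move=> lD; rewrite mE sum_E_mul.
  have m0 l : (l <= D)%N -> (h.+1 < l)%N -> m l = 0.
    move=> lD lt; have := (Qp lD hD').1; rewrite mE' // => /(_ _)/eqP.
    rewrite scaler_eq0 (negPf (E_neq0 lD)) orbF => h0.
    by apply/eqP/h0; apply/orP; left; lia.
  have mS : m h.+1 != 0.
    have := (Qp hD hD').2; rewrite mE' // eqxx => /(_ isT).
    by rewrite scaler_eq0 negb_or => /andP[].
  have ent t : E 1 x t * E h x t = \sum_(l < D.+1) m l * E l x t.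
    have := congr1 (fun M : 'M_n => M x t) mE; rewrite mxE => ->.
    by rewrite summxE; apply: eq_bigr => l _; rewrite mxE.
  have IHh : E h x y = E h x z by apply: IH => //; rewrite -ltnS.
  have entD t : E 1 x t * E h x t = m h.+1 * E h.+1 x t +
      \sum_(l < D.+1 | l != Ordinal (hD : h.+1 < D.+1)%N) m l * E l x t.
    by rewrite ent (bigD1 (Ordinal (hD : h.+1 < D.+1)%N)).
  have := entD y; rewrite e1 IHh entD.
  rewrite [X in _ = _ + X -> _](eq_bigr (fun l : 'I_D.+1 => m l * E l x z)) => [|l].
    by move=> /addIr /(mulfI mS) ->.
  move=> lh; case: (ltngtP l h.+1) => [lt|gt|e2].
  - by rewrite IH // -1?ltnS //; apply: leq_trans lt _.
  - by rewrite m0 ?mul0r // -ltnS.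
  - by case/negP: lh; apply/eqP/val_inj.
have [m mE] := BM_decomp (inBM_distmx i).
have : distmx i x y = distmx i x z.
  rewrite mE !summxE; apply: eq_bigr => l _; rewrite !mxE EE // -ltnS //.
rewrite !mxE yi zj eqxx; case: eqP => // _ /eqP; by rewrite oner_eq0.
Qed.

Lemma inT_Es i : (i <= D)%N -> inT A As (Es i).
Proof.
move=> iD; have [s [k ->]] := idem_polyprod Es_As sum_Es ths_inj iD.
apply: inTscale; elim: s => [|c s IH] /=; first exact: inT1.
apply: inTmul => //; apply: inT_sub; first exact: inTAs.
by rewrite -scalemx1; apply/inTscale/inT1.
Qed.

Lemma Es_A_Es i j : (1 < i - j)%N || (1 < j - i)%N -> Es i *m A *m Es j = 0.
Proof.
move=> ij; apply/matrixP => y z; rewrite [RHS]mxE mxE big1 // => t _.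
rewrite mxE (bigD1 y) //= big1 => [|t' t'y]; last first.
  by rewrite mxE eq_sym (negPf t'y) mul0r.
rewrite !mxE eqxx addr0 /=; case: eqP => [yi|_]; last by rewrite !mul0r.
case: (boolP (adj y t)) => yt; last by rewrite mulr0 mul0r.
case: eqP => [_|_] /=; rewrite ?mulr0 //; case: eqP => [tj|]; rewrite ?mulr0 //.
have := gdist_adj conn x yt; rewrite sg.1 in yt; have := gdist_adj conn x yt.
by move: ij; lia.
Qed.

Lemma E_As_E i j : (i <= D)%N -> (j <= D)%N ->
  (1 < i - j)%N || (1 < j - i)%N -> E i *m As *m E j = 0.
Proof.
move=> iD jD ij; apply: trmxC_trace_eq0.
rewrite !trmxC_mul As_herm !E_herm // !mulmxA.
rewrite mxtrace_mulC !mulmxA E_idem // -(mulmxA _ (E j) (E j)) E_idem //.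
have [m mE] := BM_decomp (inBM_hada (E_BM iD) (E_BM jD)).
have HE : hada (E i) (E j) *m E 1 = m 1%N *: E 1 by rewrite mE sum_E_mul.
have es k (kD : (k <= D)%N) y z : E k z y = E k y z by rewrite -[in LHS](E_sym kD) mxE.
(* For symmetric matrices tr((F o G) H) is symmetric in F, G, H, so the Krein condition for (E_1 o
   E_j) E_i applies. *)
have K : \tr (hada (E i) (E j) *m E 1) = 0.
  have := (Qp iD jD).1 ij => /(congr1 (fun M => \tr M)); rewrite mxtrace0 => <-.
  rewrite /mxtrace; apply: eq_bigr => y _; rewrite !mxE; apply: eq_bigr => z _.
  by rewrite (es _ D0 y z) (es _ iD y z) !mxE; ring.
have m0 : m 1%N = 0.
  move/eqP: K; rewrite HE mxtraceZ mulf_eq0 (negPf (E_trace D0)) orbF.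
  by move/eqP.
have H0 : hada (E i) (E j) *m E 1 = 0 by rewrite HE m0 scale0r.
have AsE (M : 'M[C]_n) y z : (M *m As) y z = M y z * (n%:R * E 1 x z).
  rewrite mxE (bigD1 z) //= big1 => [|t tz]; last by rewrite mxE (negPf tz) mul0r mulr0.
  by rewrite mxE eqxx mul1r addr0.
transitivity (\sum_y (n%:R * E 1 x y) * (n%:R * (hada (E i) (E j) *m E 1) y x)).
  apply: eq_bigr => y _; rewrite AsE mulrC; congr (_ * _).
  rewrite !mxE mulr_sumr; apply: eq_bigr => z _; rewrite AsE !mxE.
  by rewrite (es _ D0 x z) (es _ jD y z); ring.
by apply: big1 => y _; rewrite H0 mxE !mulr0.
Qed.

End BoseMesner.

(** * Thin irreducible modules *)

Section Support.
Variables (F : fieldType) (n D : nat) (P : nat -> 'M[F]_n) (X Y W : 'M[F]_n) (c : nat -> F).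
Hypothesis P_out : forall i, (D < i)%N -> P i = 0.
Hypothesis P_mul : forall i j, P i *m P j = if i == j then P i else 0.
Hypothesis P_sum : \sum_(i < D.+1) P i = 1%:M.
Hypothesis PX : forall i, P i *m X = c i *: P i.
Hypothesis PYP : forall i j, (1 < i - j)%N || (1 < j - i)%N -> P i *m Y *m P j = 0.
Hypothesis WP : forall i, (W *m P i <= W)%MS.
Hypothesis WY : (W *m Y <= W)%MS.
Hypothesis W_neq0 : W != 0.
Hypothesis W_irr : forall U : 'M[F]_n, (U <= W)%MS -> (U *m X <= U)%MS -> (U *m Y <= U)%MS ->
  U = 0 \/ (W <= U)%MS.

Lemma idem_decomp m (v : 'M[F]_(m, n)) : v = \sum_(i < D.+1) v *m P i.
Proof. by rewrite -mulmx_sumr P_sum mulmx1. Qed.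

Lemma idem_ext0 m (v : 'M[F]_(m, n)) : (forall i, v *m P i = 0) -> v = 0.
Proof. by move=> h; rewrite [v]idem_decomp big1. Qed.

(** If [Y] never leads out of [J], the part of [W] supported on [J] is a submodule, so it is zero or
    all of [W]. *)
Lemma support_gap (J : pred nat) :
  (forall i k, J i -> ~~ J k -> W *m P i *m Y *m P k = 0) ->
  (forall i, J i -> W *m P i = 0) \/ (forall k, ~~ J k -> W *m P k = 0).
Proof.
move=> hJ; pose U : 'M_n := W *m \sum_(i < D.+1 | J i) P i.
have UP k : U *m P k = if J k then W *m P k else 0.
  rewrite /U -mulmxA mulmx_suml; case: (leqP k D) => [kD|Dk]; last first.
    by rewrite (P_out Dk) !mulmx0 big1 ?mulmx0 ?if_same // => i _; rewrite mulmx0.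
  case: (boolP (J k)) => Jk; last first.
    rewrite big1 ?mulmx0 // => i Ji; rewrite P_mul; case: eqP => // e.
    by rewrite -e Ji in Jk.
  rewrite (bigD1 (Ordinal (kD : k < D.+1)%N)) //= big1 ?addr0 ?P_mul ?eqxx // => i /andP[_ ik].
  rewrite P_mul; case: eqP => // e; case/negP: ik; apply/eqP/val_inj; exact: e.
have UW : (U <= W)%MS by rewrite /U mulmx_sumr summx_sub.
have subU V : (V <= W)%MS -> (forall k, ~~ J k -> V *m P k = 0) -> (V <= U)%MS.
  move=> /submxP[Z ->] VP; rewrite [Z *m W]idem_decomp.
  apply: summx_sub => i _; case: (boolP (J i)) => Ji; last by rewrite VP ?sub0mx.
  have -> : Z *m W *m P i = Z *m (W *m (\sum_(i < D.+1 | J i) P i) *m P i).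
    by have := UP i; rewrite Ji /U => ->; rewrite mulmxA.
  rewrite mulmx_sub // -mulmxA.
  have -> : (\sum_(i0 < D.+1 | J i0) P i0) *m P i = P i *m (\sum_(i0 < D.+1 | J i0) P i0).
    rewrite mulmx_suml mulmx_sumr; apply: eq_bigr => k _.
    by rewrite !P_mul eq_sym; case: eqP => // ->.
  by rewrite mulmxA submxMr.
case: (@W_irr U) => //.
- rewrite /U -mulmxA mulmx_suml (eq_bigr (fun i : 'I_D.+1 => P i *m (c i)%:M)) => [|i _].
    apply: subU; rewrite ?mulmx_sumr.
      by apply: summx_sub => i _; rewrite mul_mx_scalar -scalemxAr scalemx_sub.
    move=> k Jk; rewrite mulmx_suml big1 // => i Ji; rewrite mul_mx_scalar -scalemxAr -scalemxAl.
    rewrite -mulmxA P_mul; case: eqP => [e|_]; last by rewrite mulmx0 scaler0.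
    by rewrite -e Ji in Jk.
  by rewrite PX mul_mx_scalar.
- apply: subU; first by apply: submx_trans (submxMr _ UW) WY.
  move=> k Jk; rewrite /U mulmx_sumr !mulmx_suml big1 // => i Ji; exact: hJ.
- by move=> U0; left=> i Ji; have := UP i; rewrite U0 mul0mx Ji.
move=> WU; right=> k Jk; apply/eqP; rewrite -submx0.
by apply: submx_trans (submxMr _ WU) _; rewrite UP (negPf Jk) submx0.
Qed.

(** [r] is the first index in the support and [r + e] the last before the next gap. [W] has no
    component at either neighbour of this interval, so tridiagonal [Y] cannot leave it. *)
Lemma interval_support :
  exists r e, (r + e <= D)%N /\ forall i, (W *m P i != 0) = (r <= i <= r + e)%N.
Proof.
have exr : exists i, W *m P i != 0.
  apply: contrapT => nex; case/eqP: W_neq0; apply: idem_ext0 => i.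
  by apply/eqP; apply: contrapT => h; apply: nex; exists i; apply/negP.
have exe r : exists e, W *m P (r + e).+1 == 0.
  by exists D; rewrite P_out ?mulmx0 //; lia.
case: (ex_minnP exr) => r Wr minr; case: (ex_minnP (exe r)) => e We mine.
have lo i : (i < r)%N -> W *m P i = 0.
  by move=> ir; apply/eqP; apply: contraTT ir => /minr; rewrite -leqNgt.
have mid i : (r <= i <= r + e)%N -> W *m P i != 0.
  move=> /andP[ri ie]; case: (eqVneq i r) => [->//|nir].
  have := mine (i - r.+1)%N; have -> : (r + (i - r.+1)).+1 = i by lia.
  by move=> mn; apply/negP => /mn; lia.
have reD : (r + e <= D)%N.
  rewrite leqNgt; apply: contraL (mid (r + e)%N _) => [h|]; last by lia.
  by rewrite negbK P_out ?mulmx0.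
exists r, e; split => // i; case: (boolP (r <= i <= r + e)%N) => [/mid //|out].
case: (support_gap (J := fun i => (r <= i <= r + e)%N)).
- move=> j k Jj Jk; case: (boolP ((1 < j - k)%N || (1 < k - j)%N)) => [far|near].
    by rewrite -!mulmxA (mulmxA (P j)) PYP ?mulmx0.
  have Wk : W *m P k = 0.
    have [kr|->] : (k < r)%N \/ k = (r + e).+1 by move: Jj Jk near; lia.
      exact: lo.
    exact/eqP.
  apply/eqP; rewrite -submx0 -[X in (_ <= X)%MS]Wk submxMr //.
  by apply: submx_trans (submxMr _ (WP _)) WY.
- by move=> /(_ r) h; case/eqP: Wr; apply: h; lia.
by move=> /(_ i out) ->; rewrite eqxx.
Qed.

(** Otherwise the indices up to [r + j] would cut out a nonzero proper submodule. *)
Lemma interval_connected r e : (forall i, (W *m P i != 0) = (r <= i <= r + e)%N) ->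
  forall j, (j < e)%N -> W *m P (r + j) *m Y *m P (r + j.+1) != 0.
Proof.
move=> supp j je; apply/negP => /eqP h0.
case: (support_gap (J := fun i => (i <= r + j)%N)).
- move=> i k Ji Jk; case: (boolP ((1 < i - k)%N || (1 < k - i)%N)) => [far|near].
    by rewrite -!mulmxA (mulmxA (P i)) PYP ?mulmx0.
  have -> : i = (r + j)%N by move: Ji Jk near; lia.
  by have -> : k = (r + j.+1)%N by move: Ji Jk near; lia.
- move=> /(_ r) h; have := supp r; rewrite h ?eqxx; last by lia.
  by rewrite leqnn leq_addr.
move=> /(_ (r + j.+1)%N) h; have := supp (r + j.+1)%N; rewrite h ?eqxx; last by lia.
by rewrite leq_addr leq_add2l je.
Qed.

Lemma rank_idem_sum : \rank W = (\sum_(i < D.+1) \rank (W *m P i))%N.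
Proof.
have dx : mxdirect (\sum_(i < D.+1) <<W *m P i>>).
  apply/mxdirect_sumsP => i _; apply/eqP; rewrite -submx0; apply/rV_subP => v.
  rewrite sub_capmx genmxE => /andP[/submxP[y ev] vs].
  have vi : v *m P i = v by rewrite ev -!mulmxA P_mul eqxx.
  rewrite -vi submx0; apply/eqP/sub_kermxP; apply: submx_trans vs _.
  apply/sumsmx_subP => j ji; rewrite genmxE; apply/sub_kermxP.
  by rewrite -mulmxA P_mul; case: eqP => [e|]; rewrite ?mulmx0 //; case/negP: ji; apply/eqP/val_inj.
have e : (W :=: \sum_(i < D.+1) <<W *m P i>>)%MS.
  apply/eqmxP/andP; split; last by apply/sumsmx_subP => i _; rewrite genmxE.
  by rewrite {1}[W]idem_decomp summx_sub_sums // => i _; rewrite genmxE.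
rewrite e (mxdirectP dx) /=; by apply: eq_bigr => i _; rewrite genmxE.
Qed.
End Support.

Lemma find_interval (D r e : nat) (p : pred nat) : (r + e <= D)%N ->
  (forall i, (i <= D)%N -> p i = (r <= i <= r + e)%N) -> find p (iota 0 D.+1) = r.
Proof.
move=> reD hp; have -> : D.+1 = (r + (D - r).+1)%N by lia.
rewrite iotaD find_cat add0n; case: (boolP (has p (iota 0 r))) => [/hasP[j]|_].
  by rewrite mem_iota => hi; rewrite hp; lia.
by rewrite size_iota /= hp ?leqnn ?leq_addr ?addn0 //; lia.
Qed.

Lemma count_interval (D r e : nat) (p : pred nat) : (r + e <= D)%N ->
  (forall i, (i <= D)%N -> p i = (r <= i <= r + e)%N) -> count p (iota 0 D.+1) = e.+1.
Proof.
move=> reD hp; have -> : D.+1 = (r + (e.+1 + (D - (r + e))))%N by lia.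
rewrite !iotaD !count_cat add0n.
have -> : count p (iota 0 r) = 0%N.
  by apply/eqP; rewrite -leqn0 leqNgt -has_count; apply/hasPn => i; rewrite mem_iota => hi; rewrite hp; lia.
have -> : count p (iota (r + e.+1) (D - (r + e))) = 0%N.
  by apply/eqP; rewrite -leqn0 leqNgt -has_count; apply/hasPn => i; rewrite mem_iota => hi; rewrite hp; lia.
rewrite add0n addn0 -[RHS](size_iota r e.+1); apply/eqP; rewrite -all_count.
by apply/allP => i; rewrite mem_iota => hi; rewrite hp; lia.
Qed.

Lemma rank1_span (F : fieldType) m n (M : 'M[F]_(m, n)) (v w : 'rV[F]_n) :
  (\rank M <= 1)%N -> v != 0 -> (v <= M)%MS -> (w <= M)%MS -> exists c, w = c *: v.
Proof.
move=> r1 v0 vM wM.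
have Mv : (M <= v)%MS.
  by rewrite -(geq_leqif (mxrank_leqif_sup vM)) rank_rV v0.
by have /sub_rVP[c ->] := submx_trans wM Mv; exists c.
Qed.

Local Ltac nat_lia :=
  repeat match goal with H : forall _, _ |- _ => clear H end;
  repeat match goal with H : is_true (submx _ _) |- _ => clear H end;
  lia.

(** * The split basis of a thin irreducible module *)

Section ThinModule.
Variables (F : fieldType) (n D : nat) (A B W : 'M[F]_n) (E Es : nat -> 'M[F]_n).
Variables (tA tB : nat -> F).
Hypothesis E_mul : forall i j, E i *m E j = if i == j then E i else 0.
Hypothesis E_sum : \sum_(i < D.+1) E i = 1%:M.
Hypothesis AE : forall i, A *m E i = tA i *: E i.
Hypothesis EBE : forall i j, (1 < i - j)%N || (1 < j - i)%N -> E i *m B *m E j = 0.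
Hypothesis Es_out : forall i, (D < i)%N -> Es i = 0.
Hypothesis Es_mul : forall i j, Es i *m Es j = if i == j then Es i else 0.
Hypothesis Es_sum : \sum_(i < D.+1) Es i = 1%:M.
Hypothesis EsB : forall i, Es i *m B = tB i *: Es i.
Hypothesis BEs : forall i, B *m Es i = tB i *: Es i.
Hypothesis EsAEs : forall i j, (1 < i - j)%N || (1 < j - i)%N -> Es i *m A *m Es j = 0.
Hypothesis WE : forall i, (W *m E i <= W)%MS.
Hypothesis WEs : forall i, (W *m Es i <= W)%MS.
Hypothesis WA : (W *m A <= W)%MS.
Hypothesis WB : (W *m B <= W)%MS.
Hypothesis W_irr : forall U : 'M[F]_n, (U <= W)%MS -> (U *m A <= U)%MS -> (U *m B <= U)%MS ->
  U = 0 \/ (W <= U)%MS.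
Hypothesis W_thin : forall i, (\rank (W *m Es i) <= 1)%N.
Variables (rho tau d e : nat).
Hypothesis rdD : (rho + d <= D)%N.
Hypothesis teD : (tau + e <= D)%N.
Hypothesis supps : forall i, (W *m Es i != 0) = (rho <= i <= rho + d)%N.
Hypothesis supp : forall i, (W *m E i != 0) = (tau <= i <= tau + e)%N.
Variable w0 : 'rV[F]_n.
Hypothesis w0_neq0 : w0 != 0.
Hypothesis w0W : (w0 <= W *m Es rho)%MS.
Variable et : nat -> F.

(** The shifts [et] stay arbitrary until [dual_diam] is proved; only then are they specialised to
    the descending eigenvalues. *)
Fixpoint split_vec_rec (i : nat) : 'rV[F]_n :=
  if i is j.+1 then split_vec_rec j *m (A - (et j)%:M) else w0.

Fact split_vec_key : unit. Proof. exact: tt. Qed.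
(* Locked: otherwise unification unfolds [u i.+1] into a matrix product. *)
Definition split_vec := locked_with split_vec_key split_vec_rec.
Local Notation u := split_vec.

Lemma split_vec0 : u 0 = w0.
Proof. by rewrite /split_vec unlock. Qed.

Lemma split_vecS i : u i.+1 = u i *m (A - (et i)%:M).
Proof. by rewrite /split_vec unlock. Qed.

Lemma sum_support (r m : nat) (P : nat -> 'M[F]_n) : (r + m <= D)%N ->
  (forall i, (W *m P i != 0) = (r <= i <= r + m)%N) ->
  forall f : nat -> nat, (forall i, W *m P i = 0 -> f i = 0%N) ->
  (\sum_(i < D.+1) f i = \sum_(j < m.+1) f (r + j))%N.
Proof.
move=> rm hP f f0.
have z i : ~~ (r <= i <= r + m)%N -> f i = 0%N.
  by rewrite -hP negbK => /eqP /f0.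
rewrite -(big_mkord xpredT f) (big_cat_nat (n := r)) //=; last by nat_lia.
rewrite (big_cat_nat (n := (r + m).+1) (m := r)) //=; try nat_lia.
rewrite big_nat_cond big1 => [|i hi]; last by apply: z; nat_lia.
rewrite add0n [X in (_ + X)%N]big_nat_cond [X in (_ + X)%N]big1 => [|i hi]; last by apply: z; nat_lia.
rewrite addn0 -{1}[r]add0n big_addn (_ : (r + m).+1 - r = m.+1)%N ?big_mkord; last by nat_lia.
by apply: eq_bigr => i _; rewrite addnC.
Qed.

Lemma rank_thin (r m : nat) (P : nat -> 'M[F]_n) : (r + m <= D)%N ->
  (forall i j, P i *m P j = if i == j then P i else 0) ->
  \sum_(i < D.+1) P i = 1%:M -> (forall i, (W *m P i <= W)%MS) ->
  (forall i, (W *m P i != 0) = (r <= i <= r + m)%N) ->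
  (forall i, (\rank (W *m P i) <= 1)%N) -> \rank W = m.+1.
Proof.
move=> rm Pm Ps WPs hP thin.
rewrite (rank_idem_sum Pm Ps WPs) (sum_support rm hP (f := fun i => \rank (W *m P i))) => [|i ->].
  rewrite -[RHS](card_ord m.+1) -sum1_card; apply: eq_bigr => j _.
  apply/eqP; rewrite eqn_leq thin lt0n mxrank_eq0 hP; have := ltn_ord j; nat_lia.
exact: mxrank0.
Qed.

Lemma W_neq0 : W != 0.
Proof.
apply: contraNneq w0_neq0 => W0; move: w0W.
by rewrite W0 mul0mx submx0.
Qed.

Lemma rank_W : \rank W = d.+1.
Proof. exact: rank_thin rdD Es_mul Es_sum WEs supps W_thin. Qed.

Lemma w0_Es : w0 *m Es rho = w0.
Proof. by have /submxP[y ->] := w0W; rewrite -!mulmxA Es_mul eqxx. Qed.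

Lemma split_vec_sub i : (u i <= W)%MS.
Proof.
elim: i => [|i IH]; rewrite ?split_vec0 ?split_vecS; first exact: submx_trans w0W (WEs _).
rewrite mulmxBr mul_mx_scalar addmx_sub ?eqmx_opp ?scalemx_sub //.
exact: submx_trans (submxMr _ IH) WA.
Qed.

Lemma W_below (v : 'rV[F]_n) i : (v <= W)%MS -> ~~ (rho <= i <= rho + d)%N -> v *m Es i = 0.
Proof.
move=> /submxP[y ->]; rewrite -supps negbK => /eqP h.
by rewrite -mulmxA h mulmx0.
Qed.

Lemma split_vec_high i k : (i < k)%N -> u i *m Es (rho + k) = 0.
Proof.
elim: i k => [|i IH] k ik; rewrite ?split_vec0 ?split_vecS.
  by rewrite -w0_Es -mulmxA Es_mul; case: eqP => [|_]; rewrite ?mulmx0 //; nat_lia.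
rewrite mulmxBr mulmxBl mul_mx_scalar -scalemxAl IH ?scaler0 ?subr0; last by nat_lia.
rewrite [u i](idem_decomp Es_sum) !mulmx_suml big1 // => j _.
case: (boolP ((1 < j - (rho + k))%N || (1 < (rho + k) - j)%N)) => [far|near].
  by rewrite -!mulmxA (mulmxA (Es j)) EsAEs ?mulmx0.
case: (leqP rho j) => rj; last by rewrite W_below ?split_vec_sub ?mul0mx //; nat_lia.
have -> : (j : nat) = (rho + (j - rho))%N by nat_lia.
by rewrite IH ?mul0mx //; nat_lia.
Qed.

(** By thinness the component of u_i at rho+i spans E*_(rho+i) W, so if A did not carry it on to
    rho+i+1, the support would be disconnected. *)
Lemma split_vec_diag i : (i <= d)%N -> u i *m Es (rho + i) != 0.
Proof.
elim: i => [|i IH] id; rewrite ?split_vec0 ?split_vecS; first by rewrite addn0 w0_Es.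
rewrite mulmxBr mulmxBl mul_mx_scalar -scalemxAl split_vec_high // scaler0 subr0.
have ui := IH (ltnW id).
have -> : u i *m A *m Es (rho + i.+1) = u i *m Es (rho + i) *m A *m Es (rho + i.+1).
  have lt : (rho + i < D.+1)%N by nat_lia.
  rewrite {1}[u i](idem_decomp Es_sum) !mulmx_suml (bigD1 (Ordinal lt)) //= big1 ?addr0 // => j ji.
  have ji' : (j : nat) != (rho + i)%N by [].
  case: (boolP ((1 < j - (rho + i.+1))%N || (1 < (rho + i.+1) - j)%N)) => [far|near].
    by rewrite -!mulmxA (mulmxA (Es j)) EsAEs ?mulmx0.
  have -> : (j : nat) = (rho + (j - rho))%N by nat_lia.
  by rewrite split_vec_high ?mul0mx //; nat_lia.
have con := interval_connected Es_out Es_mul Es_sum EsB EsAEs WEs WA W_neq0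
  (fun U h1 h2 h3 => W_irr h1 h3 h2) supps id.
apply: contraNneq con => h0; apply/eqP/row_matrixP => k.
rewrite !row_mul row0.
have [|c] := rank1_span (W_thin (rho + i)) ui _ (row_sub k _).
  by rewrite submxMr ?split_vec_sub.
rewrite row_mul => ->.
by rewrite -!scalemxAl h0 scaler0.
Qed.

Lemma flag_span m (v : 'rV[F]_n) : (m <= d.+1)%N -> (v <= W)%MS ->
  (forall k, (m <= k)%N -> v *m Es (rho + k) = 0) ->
  exists c : nat -> F, v = \sum_(j < m) c j *: u j.
Proof.
elim: m v => [|m IH] v md vW hv.
  exists (fun=> 0); rewrite big_ord0; apply: (idem_ext0 Es_sum) => i.
  case: (boolP (rho <= i <= rho + d)%N) => hi; last exact: W_below.
  by rewrite -(@subnKC rho i) ?hv //; nat_lia.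
have [c hc] := rank1_span (W_thin (rho + m)) (split_vec_diag md)
  (submxMr _ (split_vec_sub m)) (submxMr _ vW).
have [||k mk|c' hc'] := IH (v - c *: u m); first exact: ltnW.
- by rewrite addmx_sub ?eqmx_opp ?scalemx_sub ?split_vec_sub.
- rewrite mulmxBl -scalemxAl; move: mk; rewrite leq_eqVlt => /orP[/eqP<-|mk].
    by rewrite hc subrr.
  by rewrite hv // split_vec_high // scaler0 subr0.
exists (fun j => if j == m then c else c' j).
rewrite big_ord_recr /= eqxx -[LHS](subrK (c *: u m)) hc'; congr (_ + _).
by apply: eq_bigr => j _; rewrite ltn_eqF.
Qed.

Lemma split_vec_span (v : 'rV[F]_n) : (v <= W)%MS -> exists c : nat -> F, v = \sum_(j < d.+1) c j *: u j.
Proof. by move=> vW; apply: flag_span => // k dk; apply: W_below => //; nat_lia. Qed.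

Lemma split_vec_E i k : u i *m E k = (\prod_(j < i) (tA k - et j)) *: (w0 *m E k).
Proof.
elim: i => [|i IH]; rewrite ?split_vec0 ?split_vecS; first by rewrite big_ord0 scale1r.
rewrite -mulmxA mulmxBl AE mul_scalar_mx -scalerBl -scalemxAr IH scalerA.
by rewrite big_ord_recr /= mulrC.
Qed.

(** The u_j span [W], and each is w0 times a polynomial in A, which acts on the image of [E k] as a
    scalar. *)
Lemma dual_thin k : (W *m E k <= w0 *m E k)%MS.
Proof.
apply/row_subP => i; rewrite row_mul.
have [c ->] := split_vec_span (row_sub i W).
rewrite mulmx_suml; apply: summx_sub => j _.
by rewrite -scalemxAl split_vec_E !scalemx_sub.
Qed.

(** Both decompositions of [W] into lines count its dimension. *)
Lemma dual_diam : e = d.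
Proof.
have thin k : (\rank (W *m E k) <= 1)%N.
  by apply: leq_trans (mxrankS (dual_thin k)) (rank_leq_row _).
have := rank_thin teD E_mul E_sum WE supp thin.
by rewrite rank_W => -[].
Qed.

Lemma w0E_neq0 k : (k <= d)%N -> w0 *m E (tau + k) != 0.
Proof.
move=> kd; have := supp (tau + k)%N; rewrite leq_addr leq_add2l dual_diam kd.
apply: contraTneq => h0; have := dual_thin (tau + k).
by rewrite h0 => /submx0null ->; rewrite eqxx.
Qed.

Variables (q s t : F).
Hypotheses (q0 : q != 0) (s0 : s != 0) (t0 : t != 0) (q4 : q ^+ 4 != 1).
Hypothesis etE : forall i, et i = eig_desc q s i.
Hypothesis tA_eta : forall i, (i <= d)%N -> tA (tau + (d - i)) = eig_desc q s i.
Hypothesis tB_zeta : forall i, (i <= d)%N -> tB (rho + i) = dual_eig q t i.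
Hypothesis tA_inj : forall i j, (i <= D)%N -> (j <= D)%N -> tA i = tA j -> i = j.
Hypothesis tB_inj : forall i j, (i <= D)%N -> (j <= D)%N -> tB i = tB j -> i = j.
Hypothesis qn_d : forall i, (0 < i <= d)%N -> qn q i != 0.

(** The factor with index d-m in [split_vec_E] is zero. This is the second flag: u_i has no
    component beyond E_(tau+d-i). *)
Lemma split_vec_E_eq0 i m : (m <= d)%N -> (d < i + m)%N -> u i *m E (tau + m) = 0.
Proof.
move=> md im; have lt : (d - m < i)%N by nat_lia.
rewrite split_vec_E (bigD1 (Ordinal lt)) //= etE -tA_eta; last by nat_lia.
by rewrite (_ : d - (d - m) = m)%N ?subrr ?mul0r ?scale0r //; nat_lia.
Qed.

Lemma split_vec_E_neq0 i : (i <= d)%N -> u i *m E (tau + (d - i)) != 0.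
Proof.
move=> id; rewrite split_vec_E scaler_eq0 negb_or w0E_neq0 ?andbT ?leq_subr //.
apply/prodf_neq0 => j _; rewrite etE -tA_eta; last by have := ltn_ord j; nat_lia.
rewrite subr_eq0; apply/eqP => /tA_inj h; have := ltn_ord j; have := dual_diam.
by move: h teD; nat_lia.
Qed.

Lemma split_vec_out i : (d < i)%N -> u i = 0.
Proof.
move=> di; apply: (idem_ext0 E_sum) => k.
have ed := dual_diam.
case: (boolP (tau <= k <= tau + e)%N) => hk.
  by rewrite -(@subnKC tau k) ?split_vec_E_eq0 //; nat_lia.
move: hk; rewrite -supp negbK => /eqP h.
by have /submxP[y ->] := split_vec_sub i; rewrite -mulmxA h mulmx0.
Qed.

Lemma split_vec_A i : u i *m A = eig_desc q s i *: u i + u i.+1.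
Proof. by rewrite split_vecS mulmxBr mul_mx_scalar etE addrC subrK. Qed.

Lemma split_vec_B_flag i : (i <= d)%N ->
  exists c : nat -> F, u i *m B - dual_eig q t i *: u i = \sum_(j < i) c j *: u j.
Proof.
move=> id; apply: flag_span; first by nat_lia.
  rewrite addmx_sub ?eqmx_opp ?scalemx_sub ?split_vec_sub //.
  exact: submx_trans (submxMr _ (split_vec_sub i)) WB.
move=> k; rewrite mulmxBl -mulmxA BEs -scalemxAr -scalemxAl leq_eqVlt => /orP[/eqP<-|ik].
  by rewrite tB_zeta // subrr.
by rewrite split_vec_high // !scaler0 subrr.
Qed.

Lemma split_vec_B0 : u 0 *m B = dual_eig q t 0 *: u 0.
Proof.
have [c] := split_vec_B_flag (leq0n d); rewrite big_ord0 => /eqP.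
by rewrite subr_eq0 => /eqP.
Qed.

(** By the first flag the difference is a combination of u_0, ..., u_i. By the second, [B] raises
    u_(i+1) at most to E_(tau+d-i), so the components at tau+d-j kill the coefficients with j < i
    one after another, from j = 0 upwards. *)
Lemma split_vec_BS i : (i < d)%N ->
  exists p, u i.+1 *m B = dual_eig q t i.+1 *: u i.+1 + p *: u i.
Proof.
move=> id; have [c hc] := split_vec_B_flag id.
have c0 j : (j < i)%N -> c j = 0.
  have [k] := ubnP j; elim: k j => // k IH j jk ji.
  have := congr1 (fun v => v *m E (tau + (d - j))) hc.
  rewrite mulmxBl -scalemxAl split_vec_E_eq0 ?scaler0 ?subr0; try nat_lia.
  have -> : u i.+1 *m B *m E (tau + (d - j)) = 0.
    rewrite [u i.+1](idem_decomp E_sum) !mulmx_suml big1 // => l _.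
    case: (boolP ((1 < l - (tau + (d - j)))%N || (1 < (tau + (d - j)) - l)%N)) => [far|near].
      by rewrite -!mulmxA (mulmxA (E l)) EBE ?mulmx0.
    case: (leqP l (tau + d)) => ld.
      by rewrite -(@subnKC tau l) ?split_vec_E_eq0 ?mul0mx //; nat_lia.
    have h : W *m E l = 0 by apply/eqP; rewrite -[_ == _]negbK supp dual_diam; nat_lia.
    by have /submxP[y ->] := split_vec_sub i.+1; rewrite -(mulmxA y) h mulmx0 !mul0mx.
  rewrite mulmx_suml (bigD1 (Ordinal (ltnW ji : j < i.+1)%N)) //= big1 => [|l lj].
    rewrite addr0 -scalemxAl => /esym/eqP; rewrite scaler_eq0.
    by rewrite (negPf (split_vec_E_neq0 _)) ?orbF; [move/eqP|nat_lia].
  have lj' : (l : nat) != j by [].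
  have li := ltn_ord l.
  rewrite -scalemxAl; case: (ltnP l j) => h; first by rewrite IH ?scale0r //; nat_lia.
  by rewrite split_vec_E_eq0 ?scaler0 //; nat_lia.
exists (c i); apply/eqP; rewrite addrC -subr_eq hc big_ord_recr /=.
rewrite big1 ?add0r // => j _.
by rewrite c0 ?scale0r.
Qed.

Lemma split_vec_Es_rho : exists f : nat -> F, forall i, u i *m Es rho = f i *: w0.
Proof.
suff /boolp.choice[f hf] (i : nat) : exists c, u i *m Es rho = c *: w0 by exists f.
exact: rank1_span (W_thin rho) w0_neq0 w0W (submxMr _ (split_vec_sub i)).
Qed.

(** If [p] vanished, u_(i+1), ..., u_d would span a nonzero submodule of dimension at most d-i. *)
Lemma split_coef_neq0 i p : (i < d)%N ->
  u i.+1 *m B = dual_eig q t i.+1 *: u i.+1 + p *: u i -> p != 0.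
Proof.
move=> id hp; apply: contraTneq (ltnSn d) => p0; rewrite -leqNgt -rank_W.
pose M := \matrix_(j < d - i) u (i.+1 + j).
have MP j : (i < j)%N -> (u j <= M)%MS.
  case: (leqP j d) => jd ij; last by rewrite split_vec_out ?sub0mx.
  have lt : (j - i.+1 < d - i)%N by nat_lia.
  have -> : u j = row (Ordinal lt) M by rewrite rowK; congr split_vec; rewrite subnKC.
  exact: row_sub.
have MA : (M *m A <= M)%MS.
  apply/row_subP => j; rewrite row_mul rowK split_vec_A addmx_sub ?scalemx_sub ?MP //; nat_lia.
have MB : (M *m B <= M)%MS.
  apply/row_subP => j; rewrite row_mul rowK; case: j => [[|j] jd] /=.
    by rewrite addn0 hp p0 scale0r addr0 scalemx_sub ?MP.
  have lt : (i.+1 + j < d)%N by nat_lia.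
  have [p' hp'] := split_vec_BS lt; rewrite addnS hp'.
  by rewrite addmx_sub ?scalemx_sub ?MP //; nat_lia.
have MW : (M <= W)%MS by apply/row_subP => j; rewrite rowK split_vec_sub.
have [||| M0 | WM] := W_irr (U := <<M>>%MS).
- by rewrite genmxE.
- by rewrite (eqmxMr _ (genmxE M)) genmxE.
- by rewrite (eqmxMr _ (genmxE M)) genmxE.
- have : (u i.+1 <= <<M>>)%MS by rewrite genmxE MP.
  rewrite M0 submx0 => /eqP h; have := split_vec_diag id.
  by rewrite h mul0mx eqxx.
rewrite genmxE in WM; apply: leq_trans (mxrankS WM) _.
by apply: leq_trans (rank_leq_row _) _; apply: leq_subr.
Qed.

(** [a0] is the trace occurring in phi_1, and the numerator over [qn q 1 * qn q d] is phi_1 itself.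
    For [d = 0] any [kap] will do, because then [split_phi] vanishes at 1. *)
Lemma split_vec_phi (a0 kap : F) : w0 *m A *m Es rho = a0 *: w0 ->
  ((0 < d)%N -> kap = s / t / q ^+ d / q + t / s * q ^+ d * q +
     (dual_eig q t 0 - dual_eig q t 1) * (a0 - eig_desc q s 0) / (qn q 1 * qn q d)) ->
  forall i, u i.+1 *m B = dual_eig q t i.+1 *: u i.+1 + split_phi q s t d kap i.+1 *: u i.
Proof.
move=> ha0 hkap i; case: (ltngtP i d) => [id|id|->]; last 2 first.
- by rewrite !split_vec_out ?mul0mx ?scaler0 ?addr0 //; nat_lia.
- rewrite split_vec_out // mul0mx scaler0 add0r /split_phi.
  by rewrite divff ?invr1 ?subrr ?mulr0 ?mul0r ?scale0r // expf_neq0.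
have d0 : (0 < d)%N by nat_lia.
have /boolp.choice[p' hp'] (j : nat) : exists p, (j < d)%N ->
    u j.+1 *m B = dual_eig q t j.+1 *: u j.+1 + p *: u j.
  case: (ltnP j d) => [jd|]; last by exists 0.
  by have [p hp] := split_vec_BS jd; exists p.
(* The value 0 at [d.+1] supplies the boundary condition of the recurrence; it is consistent since
   u_(d+1) = 0. *)
pose p j := if (0 < j <= d)%N then p' j.-1 else 0.
have uB j : u j.+1 *m B = dual_eig q t j.+1 *: u j.+1 + p j.+1 *: u j.
  rewrite /p; case: (boolP (0 < j.+1 <= d)%N) => jd; first exact: hp'.
  by rewrite split_vec_out ?mul0mx ?scaler0 ?scale0r ?addr0 //; nat_lia.
have [f hf] := split_vec_Es_rho.
have w0I (x y : F) : x *: w0 = y *: w0 -> x = y.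
  move=> /eqP; rewrite -subr_eq0 -scalerBl scaler_eq0 (negPf w0_neq0) orbF subr_eq0.
  by move/eqP.
have f0 : f 0 = 1 by apply: w0I; rewrite -hf split_vec0 w0_Es scale1r.
have flast : f d.+1 = 0 by apply: w0I; rewrite -hf split_vec_out // mul0mx scale0r.
have BEs0 : B *m Es rho = dual_eig q t 0 *: Es rho by rewrite BEs -tB_zeta ?addn0.
have f_rec j : dual_eig q t 0 * f j.+1 = dual_eig q t j.+1 * f j.+1 + p j.+1 * f j.
  apply: w0I; rewrite scalerDl -!scalerA -!hf !scalemxAl -mulmxDl -uB.
  by rewrite -mulmxA BEs0 -scalemxAr scalemxAl.
pose g j := eig_desc q s j * f j + f j.+1.
have hg j : u j *m A *m Es rho = g j *: w0.
  by rewrite split_vec_A mulmxDl -scalemxAl !hf scalerA -scalerDl.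
pose h j := (dual_eig q t j.+1 - dual_eig q t 0) * g j.+1 + p j.+1 * g j.
have hh j : (u j.+1 *m B - dual_eig q t 0 *: u j.+1) *m A *m Es rho = h j *: w0.
  rewrite uB addrAC -scalerBl !mulmxDl -!scalemxAl !hg !scalerA -scalerDl //.
have h_rec j : (j.+2 <= d)%N -> (dual_eig q t j.+2 - dual_eig q t 1) * h j.+1 + p j.+2 * h j = 0.
  move=> jd; apply: w0I; rewrite scale0r scalerDl -!scalerA -!hh.
  pose z := (u j.+2 *m B - dual_eig q t 1 *: u j.+2).
  transitivity ((z *m B - dual_eig q t 0 *: z) *m A *m Es rho).
    have -> : z = (dual_eig q t j.+2 - dual_eig q t 1) *: u j.+2 + p j.+2 *: u j.+1.
      by rewrite /z uB addrAC -scalerBl.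
    rewrite !scalemxAl -mulmxDl -mulmxDl; congr (_ *m _ *m _).
    rewrite mulmxDl -!scalemxAl.
    move: (u j.+2 *m B) (u j.+1 *m B) (u j.+2) (u j.+1) => v1 v2 v3 v4.
    by apply/rowP => k; rewrite !mxE; ring.
  have zW : (z <= W)%MS.
    rewrite addmx_sub ?eqmx_opp ?scalemx_sub ?split_vec_sub //.
    exact: submx_trans (submxMr _ (split_vec_sub _)) WB.
  (* [z] has lost its component at rho+1, and B - vartheta*_0 removes the one at rho. What remains
     sits at rho+2 and above, from where A cannot reach E*_rho. *)
  have zEs k : (k <= 1)%N -> (z *m B - dual_eig q t 0 *: z) *m Es (rho + k) = 0.
    move=> k1; rewrite mulmxBl -mulmxA BEs -scalemxAr -scalemxAl tB_zeta; last by nat_lia.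
    case: k k1 => [|[|]] // _; first by rewrite subrr.
    rewrite (_ : z *m Es (rho + 1) = 0) ?scaler0 ?subrr //.
    by rewrite mulmxBl -mulmxA BEs -scalemxAr -scalemxAl tB_zeta // subrr.
  set y := _ - _ in zEs *.
  have yW : (y <= W)%MS.
    by rewrite addmx_sub ?eqmx_opp ?scalemx_sub // (submx_trans (submxMr _ zW)).
  rewrite [y](idem_decomp Es_sum) !mulmx_suml big1 // => l _.
  case: (boolP ((1 < l - rho)%N || (1 < rho - l)%N)) => [far|near].
    by rewrite -!mulmxA (mulmxA (Es l)) EsAEs ?mulmx0.
  case: (leqP rho l) => rl; last by rewrite (W_below yW) ?mul0mx //; nat_lia.
  by rewrite -(@subnKC rho l) // zEs ?mul0mx //; nat_lia.
have dual_eig_inj k l : (k <= d)%N -> (l <= d)%N -> dual_eig q t k = dual_eig q t l -> k = l.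
  by move=> kd ld; rewrite -!tB_zeta // => /tB_inj h'; apply: (@addnI rho); apply: h'; move: rdD; nat_lia.
have p_neq0 k : (0 < k <= d)%N -> p k != 0.
  by case: k => // k kd; apply: split_coef_neq0 (uB k).
(* The recurrence for [f] gives p_1 = (vartheta*_0 - vartheta*_1) f_1, and u_0 A = vartheta_d u_0 +
   u_1 gives f_1 = a0 - vartheta_d. *)
have p1 : p 1 = (dual_eig q t 0 - dual_eig q t 1) * (a0 - eig_desc q s 0).
  have -> : a0 = g 0 by apply: w0I; rewrite -hg split_vec0.
  have := f_rec 0; rewrite /g f0 !mulr1 => e1.
  have -> : p 1 = dual_eig q t 0 * f 1 - dual_eig q t 1 * f 1 by rewrite e1; ring.
  by ring.
rewrite uB hkap // -p1; congr (_ + _ *: _).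
have p_last : p d.+1 = 0 by rewrite /p ltnn.
exact: (split_phi_unique q0 s0 t0 d0 qn_d dual_eig_inj f0 p_last p_neq0
  (fun j _ => f_rec j) flast h_rec).
Qed.

Lemma thin_aw (a0 kap : F) : w0 *m A *m Es rho = a0 *: w0 ->
  ((0 < d)%N -> kap = s / t / q ^+ d / q + t / s * q ^+ d * q +
     (dual_eig q t 0 - dual_eig q t 1) * (a0 - eig_desc q s 0) / (qn q 1 * qn q d)) ->
  let a := s / q ^+ d in let b := t * q ^+ d in
  W *m A + (q ^+ 2 - q ^- 2)^-1 *: (((q - q^-1) * aw_gamma q d kap a b) *: (W *m B)
    - (q ^+ 2 - q ^- 2)^-1 *: ((q ^+ 2 + q ^- 2) *: (W *m B *m A *m B)
      - W *m A *m B *m B - W *m B *m B *m A)) = aw_alpha q d kap a b *: W /\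
  W *m B + (q ^+ 2 - q ^- 2)^-1 *: (((q - q^-1) * aw_gamma q d kap a b) *: (W *m A)
    - (q ^+ 2 - q ^- 2)^-1 *: ((q ^+ 2 + q ^- 2) *: (W *m A *m B *m A)
      - W *m A *m A *m B - W *m B *m A *m A)) = aw_alpha q d kap b a *: W.
Proof.
move=> ha0 hkap a b; have uBS := split_vec_phi ha0 hkap.
(* Both relations are linear and the u_i span [W]. Quantifying over the number of rows lets one
   expression be read on a single u_i and on [W]. *)
have ext (f : forall m, 'M[F]_(m, n) -> 'M[F]_(m, n)) (M : 'M[F]_n) c :
    (forall m (v : 'M_(m, n)), f m v = v *m M) -> (forall i, f 1 (u i) = c *: u i) ->
    f n W = c *: W.
  move=> fM fu; rewrite fM; apply/row_matrixP => k; rewrite row_mul linearZ /=.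
  have [z ->] := split_vec_span (row_sub k W).
  rewrite mulmx_suml scaler_sumr; apply: eq_bigr => j _.
  by rewrite -scalemxAl -fM fu !scalerA mulrC.
split.
- apply: (ext (fun m (v : 'M[F]_(m, n)) => v *m A +
      (q ^+ 2 - q ^- 2)^-1 *: (((q - q^-1) * aw_gamma q d kap a b) *: (v *m B)
    - (q ^+ 2 - q ^- 2)^-1 *: ((q ^+ 2 + q ^- 2) *: (v *m B *m A *m B)
      - v *m A *m B *m B - v *m B *m B *m A)))
    (A + (q ^+ 2 - q ^- 2)^-1 *: (((q - q^-1) * aw_gamma q d kap a b) *: B
    - (q ^+ 2 - q ^- 2)^-1 *: ((q ^+ 2 + q ^- 2) *: (B *m A *m B)
      - A *m B *m B - B *m B *m A)))).
    by move=> m v; rewrite !(mulmxDr, mulmxBr, =^~ scalemxAr, mulmxN) !mulmxA.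
  by move=> i; apply: (split_aw_A q0 s0 t0 split_vec_A split_vec_B0 uBS q4).
- apply: (ext (fun m (v : 'M[F]_(m, n)) => v *m B +
      (q ^+ 2 - q ^- 2)^-1 *: (((q - q^-1) * aw_gamma q d kap a b) *: (v *m A)
    - (q ^+ 2 - q ^- 2)^-1 *: ((q ^+ 2 + q ^- 2) *: (v *m A *m B *m A)
      - v *m A *m A *m B - v *m B *m A *m A)))
    (B + (q ^+ 2 - q ^- 2)^-1 *: (((q - q^-1) * aw_gamma q d kap a b) *: A
    - (q ^+ 2 - q ^- 2)^-1 *: ((q ^+ 2 + q ^- 2) *: (A *m B *m A)
      - A *m A *m B - B *m A *m A)))).
    by move=> m v; rewrite !(mulmxDr, mulmxBr, =^~ scalemxAr, mulmxN) !mulmxA.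
  by move=> i; apply: (split_aw_B q0 s0 t0 split_vec_A split_vec_B0 uBS q4).
Qed.
End ThinModule.

(** * The q-Racah relations *)

Lemma expz_reindex_desc (F : fieldType) (q : F) (r d i D : nat) : q != 0 -> (i <= d)%N ->
  exprz q ((2 * (r + (d - i)))%N%:Z - D%:Z) =
  exprz q ((2 * r + d)%N%:Z - D%:Z) * q ^+ d / q ^+ (2 * i).
Proof. by move=> q0 id; rewrite !exprnP invr_expz -!expfzDr //; congr exprz; lia. Qed.

Lemma expz_reindex_asc (F : fieldType) (q : F) (r d i D : nat) : q != 0 ->
  exprz q ((2 * (r + i))%N%:Z - D%:Z) =
  exprz q ((2 * r + d)%N%:Z - D%:Z) / q ^+ d * q ^+ (2 * i).
Proof. by move=> q0; rewrite !exprnP invr_expz -!expfzDr //; congr exprz; lia. Qed.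

Lemma expz_dbl_sub (F : fieldType) (q : F) (d : nat) : exprz q ((2 * d)%N%:Z - d%:Z) = q ^+ d.
Proof. by have -> : (2 * d)%N%:Z - d%:Z = d%:Z by lia. Qed.

Lemma expz_sub_dbl (F : fieldType) (q : F) (d : nat) : exprz q (d%:Z - (2 * d)%N%:Z) = q ^- d.
Proof.
have -> : d%:Z - (2 * d)%N%:Z = - d%:Z by lia.
by rewrite -invr_expz.
Qed.

Section ScalarIdentities.
Variables (F : fieldType) (c c' k y z q : F).
Hypotheses (c0 : c != 0) (c'0 : c' != 0) (k0 : k != 0) (y0 : y != 0) (z0 : z != 0) (q0 : q != 0).

Lemma eig_shift_desc :
  c * (k * y / z) + c^-1 / (k * y / z) = c * k * y / z + (c * k * y)^-1 * z.
Proof. by field; rewrite c0 k0 y0 z0. Qed.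

Lemma eig_shift_asc :
  c * (k / y * z) + c^-1 / (k / y * z) = c * k / y * z + (c * k / y)^-1 / z.
Proof. by field; rewrite c0 k0 y0 z0. Qed.

Lemma dual_eig1_shift : c * (q ^+ 2 / y) + c^-1 / (q ^+ 2 / y) =
  c / y * q ^+ 2 + (c / y)^-1 / q ^+ 2.
Proof. by field; rewrite c0 y0 q0. Qed.

Lemma kappa_term1 : c / c' * (y / q) = c * y / (c' / y) / y / q.
Proof. by field; rewrite c'0 y0 q0. Qed.

Lemma kappa_term2 : c' / c * (q / y) = c' / y / (c * y) * y * q.
Proof. by field; rewrite c0 y0. Qed.
End ScalarIdentities.

Lemma trmx_qcomm (F : fieldType) n (G X Y : 'M[F]_n) (z q : F) :
  (G + z *: (q *: (X *m Y) - q^-1 *: (Y *m X)))^T =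
  G^T + z *: (q *: (Y^T *m X^T) - q^-1 *: (X^T *m Y^T)).
Proof. by rewrite linearD linearZ linearB /= !linearZ /= !trmx_mul. Qed.

Lemma mulmx_qcomm (F : fieldType) m n (W : 'M[F]_(m, n)) (G X Y : 'M[F]_n) (z q : F) :
  W *m (G + z *: (q *: (X *m Y) - q^-1 *: (Y *m X))) =
  W *m G + z *: (q *: (W *m X *m Y) - q^-1 *: (W *m Y *m X)).
Proof. by rewrite mulmxDr -scalemxAr mulmxBr -!scalemxAr !mulmxA. Qed.

(* Substituting the third Askey-Wilson relation into the other two. *)
Lemma qcomm_subst (F : fieldType) m n (T0 T1 T2 T3 T4 : 'M[F]_(m, n)) (z q g : F) : q != 0 ->
  T0 + z *: (q *: (g *: T1 - z *: (q *: T2 - q^-1 *: T3)) - q^-1 *: (g *: T1 - z *: (q *: T4 - q^-1 *: T2))) =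
  T0 + z *: (((q - q^-1) * g) *: T1 - z *: ((q ^+ 2 + q ^- 2) *: T2 - T3 - T4)).
Proof. by move=> q0; apply/matrixP => i j; rewrite !mxE; field. Qed.

(** A map whose image lies in a line has as trace its eigenvalue on that line. *)
Lemma restr_trace_rank1 (F : fieldType) n (W P M : 'M[F]_n) (w : 'rV[F]_n) a0 :
  (w <= W)%MS -> w *m (P *m M)^T = a0 *: w -> (W *m (P *m M)^T <= w)%MS ->
  restr_trace W (P *m M) = a0 \/ w = 0.
Proof.
move=> wW ha0 hW; case: (eqVneq w 0) => [->|w0]; [by right|left].
rewrite /restr_trace; set N := (P *m M)^T in ha0 hW *; set Rb := row_base W.
have /submxP[z ez] : (w <= Rb)%MS by rewrite eq_row_base.
have /submxP[k ek] : (Rb *m N <= w)%MS.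
  by apply: submx_trans hW; rewrite submxMr ?eq_row_base.
have zE : w *m pinvmx Rb = z by rewrite ez mulmxKp ?row_base_free.
rewrite ek -mulmxA zE mxtrace_mulC; have : (z *m k) *m w = a0 *: w.
  by rewrite -mulmxA -ek mulmxA -ez.
rewrite [z *m k]mx11_scalar mul_scalar_mx mxtrace_scalar mulr1n => /eqP.
by rewrite -subr_eq0 -scalerBl scaler_eq0 (negPf w0) orbF subr_eq0 => /eqP.
Qed.

(** * Normalised matrices, module parameters and assembly of the relations *)

Section QRacahModule.
Local Open Scope sesquilinear_scope.
Variables (C : numClosedFieldType) (n : nat) (adj : rel 'I_n) (D : nat).
Variables (q : C) (E : nat -> 'M[C]_n) (x : 'I_n) (w u v ws us vs a b : C).
Hypotheses (q0 : q != 0) (q4 : q ^+ 4 != 1).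
Hypotheses (sg : simple_graph adj) (conn : gconnected adj) (dr : distance_regular adj).
Hypotheses (DE : D = diam adj) (D0 : (0 < D)%N).
Hypothesis E_prim : forall i, (i <= D)%N -> prim_idem adj (E i).
Hypothesis E_inj : forall i j, (i <= D)%N -> (j <= D)%N -> E i = E j -> i = j.
Hypothesis E0 : E 0%N = (n%:R)^-1 *: const_mx 1.
Hypothesis Qp : Qpolynomial E D.
Hypotheses (u0 : u != 0) (us0 : us != 0) (v0 : v != 0) (vs0 : vs != 0).
Hypothesis A_decomp : adjmx C adj = \sum_(i < D.+1)
  (w + u * qpow q ((2 * i)%N%:Z - D%:Z) + v * qpow q (D%:Z - (2 * i)%N%:Z)) *: E i.
Hypothesis As_decomp : Astarmx (E 1%N) x = \sum_(i < D.+1)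
  (ws + us * qpow q ((2 * i)%N%:Z - D%:Z) + vs * qpow q (D%:Z - (2 * i)%N%:Z))
    *: Estar C adj x i.
Hypotheses (a2 : a ^+ 2 = u / v) (b2 : b ^+ 2 = us / vs).

Local Notation A := (adjmx C adj).
Local Notation As := (Astarmx (E 1%N) x).
Local Notation Es := (Estar C adj x).
Let th (i : nat) := w + u * qpow q ((2 * i)%N%:Z - D%:Z) + v * qpow q (D%:Z - (2 * i)%N%:Z).
Let ths (i : nat) := ws + us * qpow q ((2 * i)%N%:Z - D%:Z) + vs * qpow q (D%:Z - (2 * i)%N%:Z).
Let A_th : A = \sum_(i < D.+1) th i *: E i := A_decomp.
Let As_ths : As = \sum_(i < D.+1) ths i *: Es i := As_decomp.
Let Ab := (a * v)^-1 *: (A - w%:M).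
Let Bb := (b * vs)^-1 *: (As - ws%:M).

(** The eigenvalues of the normalised matrices: [c = a] for [Ab] and [c = b] for [Bb]. *)
Definition lam (c : C) (i : nat) : C :=
  c * qpow q ((2 * i)%N%:Z - D%:Z) + c^-1 * qpow q (D%:Z - (2 * i)%N%:Z).

Lemma affine_lam (c w' u' v' : C) (z z' : C) : u' != 0 -> v' != 0 -> c ^+ 2 = u' / v' ->
  (c * v')^-1 * ((w' + u' * z + v' * z') - w') = c * z + c^-1 * z'.
Proof.
move=> u'0 v'0 c2; have c0 : c != 0.
  apply: contraNneq u'0 => e; move: c2; rewrite e expr0n /= => /esym/eqP.
  by rewrite mulf_eq0 invr_eq0 (negPf v'0) orbF.
have -> : u' = c ^+ 2 * v' by rewrite c2 divfK.
by field; rewrite c0 v'0.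
Qed.

Lemma sqr_neq0 (c u' v' : C) : u' != 0 -> v' != 0 -> c ^+ 2 = u' / v' -> c != 0.
Proof.
move=> u'0 v'0 c2; have : c ^+ 2 != 0 by rewrite c2 mulf_neq0 ?invr_neq0.
by rewrite expf_eq0.
Qed.

Let a0 : a != 0. Proof. exact: sqr_neq0 u0 v0 a2. Qed.
Let b0 : b != 0. Proof. exact: sqr_neq0 us0 vs0 b2. Qed.

(** [E] is unconstrained beyond [D]; cutting it off by 0 makes the idempotent relations hold for all
    indices. *)
Let Ei (i : nat) : 'M[C]_n := if (i <= D)%N then E i else 0.

Let hermA : A ^t* = A. Proof. exact: adjmx_herm. Qed.
Let hermAs : As ^t* = As. Proof. exact: (As_herm sg conn DE E_prim E_inj A_th _ D0). Qed.
Let symA : A^T = A. Proof. exact: adjmx_sym. Qed.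
Let symAs : As^T = As. Proof. exact: As_sym. Qed.

Let Ei_out i : (D < i)%N -> Ei i = 0.
Proof. by rewrite /Ei ltnNge => /negPf->. Qed.

Let Ei_mul i j : Ei i *m Ei j = if i == j then Ei i else 0.
Proof.
rewrite /Ei; case: (leqP i D) => iD; last by rewrite mul0mx if_same.
case: (leqP j D) => jD; last by rewrite mulmx0; case: eqP => // e; rewrite -e ltnNge iD in jD.
case: eqP => [<-|/eqP ij]; first exact: (E_idem E_prim).
exact: (E_orth sg conn E_prim E_inj).
Qed.

Let Ei_sum : \sum_(i < D.+1) Ei i = 1%:M.
Proof.
rewrite -(sum_E sg conn DE E_prim E_inj); apply: eq_bigr => i _.
by rewrite /Ei -ltnS ltn_ord.
Qed.

Let normalize (M X : 'M[C]_n) (c : C) (w' v' a' : C) : M *m X = c *: M ->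
  M *m ((a' * v')^-1 *: (X - w'%:M)) = ((a' * v')^-1 * (c - w')) *: M.
Proof. by move=> e; rewrite -scalemxAr mulmxBr e mul_mx_scalar -scalerBl scalerA. Qed.

Let Ei_A i : Ei i *m Ab = lam a i *: Ei i.
Proof.
rewrite /Ei; case: (leqP i D) => iD; last by rewrite mul0mx scaler0.
rewrite (normalize _ _ _ (E_A sg conn E_prim E_inj A_th iD)).
by rewrite (affine_lam _ _ _ u0 v0 a2).
Qed.

Let Ab_sym : Ab^T = Ab.
Proof. by rewrite /Ab linearZ linearB /= symA tr_scalar_mx. Qed.

Let Bb_sym : Bb^T = Bb.
Proof. by rewrite /Bb linearZ linearB /= symAs tr_scalar_mx. Qed.

Let Ei_sym i : (Ei i)^T = Ei i.
Proof. by rewrite /Ei; case: ifP => iD; [exact: (E_sym sg conn E_prim)|exact: trmx0]. Qed.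

Let A_Ei i : Ab *m Ei i = lam a i *: Ei i.
Proof.
have e : (lam a i *: Ei i)^T = lam a i *: Ei i by rewrite linearZ /= Ei_sym.
by apply: trmx_inj; rewrite trmx_mul Ab_sym Ei_sym e Ei_A.
Qed.

Let Es_out i : (D < i)%N -> Es i = 0.
Proof.
move=> Di; apply/matrixP => y z; rewrite !mxE; case: (gdist adj x y =P i) => [e|]; last by rewrite andbF.
by have := gdist_le_diam adj x y; rewrite e -DE leqNgt Di.
Qed.

Let Es_B i : Es i *m Bb = lam b i *: Es i.
Proof.
case: (leqP i D) => iD; last by rewrite Es_out // mul0mx scaler0.
rewrite (normalize _ _ _ (Es_As As_ths iD)).
by rewrite (affine_lam _ _ _ us0 vs0 b2).
Qed.

Let B_Es i : Bb *m Es i = lam b i *: Es i.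
Proof.
have e : (lam b i *: Es i)^T = lam b i *: Es i by rewrite linearZ /= Es_sym.
by apply: trmx_inj; rewrite trmx_mul Bb_sym Es_sym e Es_B.
Qed.

Let tri_affine (P Q X : 'M[C]_n) (c d : C) : P *m X *m Q = 0 -> P *m Q = 0 ->
  P *m (c *: (X - d%:M)) *m Q = 0.
Proof.
move=> h1 h2; rewrite -scalemxAr -scalemxAl mulmxBr mulmxBl h1 mul_mx_scalar -scalemxAl h2.
by rewrite scaler0 subrr scaler0.
Qed.

Let Ei_B_Ei i j : (1 < i - j)%N || (1 < j - i)%N -> Ei i *m Bb *m Ei j = 0.
Proof.
move=> ij; apply: tri_affine; last by rewrite Ei_mul; case: eqP => // e; rewrite e subnn in ij.
rewrite /Ei; case: (leqP i D) => iD; last by rewrite !mul0mx.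
case: (leqP j D) => jD; last by rewrite mulmx0.
exact: (E_As_E sg conn DE E_prim E_inj A_th).
Qed.

Let Es_A_Es' i j : (1 < i - j)%N || (1 < j - i)%N -> Es i *m Ab *m Es j = 0.
Proof.
move=> ij; apply: tri_affine; last by rewrite Es_mul; case: eqP => // e; rewrite e subnn in ij.
exact: (Es_A_Es _ sg conn DE).
Qed.

Let lam_inj_of (c w' u' v' : C) i j : u' != 0 -> v' != 0 -> c ^+ 2 = u' / v' ->
  lam c i = lam c j ->
  w' + u' * qpow q ((2 * i)%N%:Z - D%:Z) + v' * qpow q (D%:Z - (2 * i)%N%:Z) =
  w' + u' * qpow q ((2 * j)%N%:Z - D%:Z) + v' * qpow q (D%:Z - (2 * j)%N%:Z).
Proof.
move=> u'0 v'0 c2; have c0 := sqr_neq0 u'0 v'0 c2.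
rewrite /lam -!(affine_lam w' _ _ u'0 v'0 c2) => /mulfI h.
by apply: (addIr (- w')); apply: h; rewrite invr_neq0 ?mulf_neq0.
Qed.

Let tA_inj i j : (i <= D)%N -> (j <= D)%N -> lam a i = lam a j -> i = j.
Proof.
move=> iD jD /(lam_inj_of w u0 v0 a2).
exact: (th_inj sg conn DE E_prim E_inj A_th x iD jD).
Qed.

Let tB_inj i j : (i <= D)%N -> (j <= D)%N -> lam b i = lam b j -> i = j.
Proof.
move=> iD jD /(lam_inj_of ws us0 vs0 b2).
exact: (ths_inj sg conn DE E_prim E_inj dr D0 E0 Qp As_ths iD jD).
Qed.

(** If q^(2i) = 1, the eigenvalues with indices [i] and 0 would coincide. *)
Let qnD_neq0 i : (0 < i <= D)%N -> qn q i != 0.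
Proof.
move=> /andP[i0 iD]; rewrite qn_neq0 //; apply/eqP => e.
suff : i = 0%N by move=> e0; rewrite e0 in i0.
apply: tA_inj => //; rewrite /lam /qpow muln0.
have e' : exprz q (2 * i)%N%:Z = 1 by rewrite -e.
have e1 : exprz q ((2 * i)%N%:Z - D%:Z) = exprz q (- D%:Z) by rewrite expfzDr // e' mul1r.
have e2 : exprz q (D%:Z - (2 * i)%N%:Z) = exprz q D%:Z.
  by rewrite expfzDr // -invr_expz e' invr1 mulr1.
by rewrite e1 e2 sub0r subr0.
Qed.

Section Module.
Variable W : 'M[C]_n.
Hypotheses (iW : irreducible A As W) (tW : thin adj x W).

Let W_Es i : (W *m Es i <= W)%MS.
Proof.
case: (leqP i D) => iD; last by rewrite Es_out // mulmx0 sub0mx.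
have [mW _ _] := iW; rewrite -(Es_sym C adj x i).
by apply: mW; apply: (inT_Es sg conn DE E_prim E_inj dr D0 E0 Qp As_ths).
Qed.

Let W_Ei i : (W *m Ei i <= W)%MS.
Proof.
case: (leqP i D) => iD; last by rewrite Ei_out // mulmx0 sub0mx.
have [mW _ _] := iW; rewrite -(Ei_sym i).
by apply: mW; rewrite /Ei iD; apply: (inT_E sg conn DE E_prim E_inj A_th).
Qed.

Let stable_affine (U X : 'M[C]_n) c d : c != 0 ->
  (U *m (c *: (X - d%:M)) <= U)%MS = (U *m X <= U)%MS.
Proof.
move=> c0; rewrite -scalemxAr eqmx_scale // mulmxBr mul_mx_scalar.
apply/idP/idP => h; last by rewrite addmx_sub ?eqmx_opp ?scalemx_sub.
by rewrite -[U *m X](subrK (d *: U)) addmx_sub ?scalemx_sub.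
Qed.

Let av0 : (a * v)^-1 != 0. Proof. by rewrite invr_neq0 ?mulf_neq0. Qed.
Let bv0 : (b * vs)^-1 != 0. Proof. by rewrite invr_neq0 ?mulf_neq0. Qed.

Let W_A : (W *m Ab <= W)%MS.
Proof. by rewrite stable_affine //; have [mW _ _] := iW; rewrite -symA; apply/mW/inTA. Qed.

Let W_B : (W *m Bb <= W)%MS.
Proof. by rewrite stable_affine //; have [mW _ _] := iW; rewrite -symAs; apply/mW/inTAs. Qed.

Let W_irr (U : 'M[C]_n) : (U <= W)%MS -> (U *m Ab <= U)%MS -> (U *m Bb <= U)%MS ->
  U = 0 \/ (W <= U)%MS.
Proof.
rewrite !stable_affine // => UW UA UB; have [_ _ minW] := iW.
case: (minW U UW) => [||/andP[_ ->]]; last by right.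
  by apply: Tmodule_gen; rewrite ?symA ?symAs.
by move=> /eqP; rewrite mxrank_eq0 => /eqP; left.
Qed.

Let W_neq0 : W != 0.
Proof. by have [_ + _] := iW; rewrite -mxrank_eq0. Qed.

Let W_thin i : (\rank (W *m Es i) <= 1)%N.
Proof. by have := tW i; rewrite /dimEstar Es_sym. Qed.

Let d := mod_diam adj x D W.
Let rho := endpoint adj x D W.
Let tau := dual_endpoint D E W.

Lemma module_supports : [/\ (rho + d <= D)%N, (tau + d <= D)%N,
  forall i, (W *m Es i != 0) = (rho <= i <= rho + d)%N &
  forall i, (W *m Ei i != 0) = (tau <= i <= tau + d)%N].
Proof.
have [r [d' [rD supps]]] := interval_support Es_out (Es_mul C adj x)
  (sum_Es C DE x) Es_B Es_A_Es' W_Es W_A W_neq0 (fun U h1 h2 h3 => W_irr h1 h3 h2).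
have [t [e [tD supp]]] := interval_support Ei_out Ei_mul Ei_sum Ei_A Ei_B_Ei W_Ei W_B W_neq0 W_irr.
have hs i : (i <= D)%N -> (dimEstar adj x W i != 0%N) = (r <= i <= r + d')%N.
  by move=> _; rewrite /dimEstar Es_sym mxrank_eq0 supps.
have he i : (i <= D)%N -> (\rank (W *m (E i)^T) != 0%N) = (t <= i <= t + e)%N.
  by move=> iD; rewrite mxrank_eq0 -supp /Ei iD (E_sym sg conn E_prim iD).
have er : rho = r by apply: find_interval rD hs.
have ed : d = d' by rewrite /d /mod_diam (count_interval rD hs).
have et : tau = t by apply: find_interval tD he.
have w0 : nz_row (W *m Es r) != 0 by rewrite nz_row_eq0 supps leqnn leq_addr.
(* The conclusion of [dual_diam] does not involve the shifts; the zero sequence is taken because the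
   intended ones depend on the parameters being determined here. *)
have ee := dual_diam Ei_mul Ei_sum A_Ei Es_out (Es_mul C adj x) (sum_Es C DE x)
  Es_B Es_A_Es' W_Ei W_Es W_A W_irr W_thin rD tD supps supp w0 (nz_row_sub _) (fun _ => 0).
by rewrite er et ed -{2 4}ee.
Qed.

Let aw := aW adj x D E q a W.
Let bw := bW adj x D q b W.

Lemma aW_neq0 : aw != 0.
Proof. by rewrite mulf_neq0 ?expfz_neq0. Qed.

Lemma bW_neq0 : bw != 0.
Proof. by rewrite mulf_neq0 ?expfz_neq0. Qed.

Let s := aw * q ^+ d.
Let t := bw / q ^+ d.

Let kap := kappa adj x D E q a b Ab W.

Lemma module_aw :
  W *m Ab + (q ^+ 2 - q ^- 2)^-1 *: (((q - q^-1) * aw_gamma q d kap aw bw) *: (W *m Bb)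
    - (q ^+ 2 - q ^- 2)^-1 *: ((q ^+ 2 + q ^- 2) *: (W *m Bb *m Ab *m Bb)
      - W *m Ab *m Bb *m Bb - W *m Bb *m Bb *m Ab)) = aw_alpha q d kap aw bw *: W /\
  W *m Bb + (q ^+ 2 - q ^- 2)^-1 *: (((q - q^-1) * aw_gamma q d kap aw bw) *: (W *m Ab)
    - (q ^+ 2 - q ^- 2)^-1 *: ((q ^+ 2 + q ^- 2) *: (W *m Ab *m Bb *m Ab)
      - W *m Ab *m Ab *m Bb - W *m Bb *m Ab *m Ab)) = aw_alpha q d kap bw aw *: W.
Proof.
have [rdD tdD supps supp] := module_supports.
have qd : q ^+ d != 0 by rewrite expf_neq0.
have s0 : s != 0 by rewrite mulf_neq0 ?aW_neq0.
have t0 : t != 0 by rewrite mulf_neq0 ?invr_neq0 ?bW_neq0.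
have w0 : nz_row (W *m Es rho) != 0 by rewrite nz_row_eq0 supps leqnn leq_addr.
set w1 := nz_row _ in w0.
have w1W : (w1 <= W *m Es rho)%MS by apply: nz_row_sub.
have [a1 ha1] : exists a1, w1 *m Ab *m Es rho = a1 *: w1.
  apply: (rank1_span (W_thin rho) w0 w1W); apply: submxMr.
  exact: submx_trans (submxMr _ (submx_trans w1W (W_Es rho))) W_A.
have lamE c i : lam c i = c * exprz q ((2 * i)%N%:Z - D%:Z) + c^-1 / exprz q ((2 * i)%N%:Z - D%:Z).
  by rewrite /lam /qpow invr_expz opprB.
have qz k : exprz q k != 0 by rewrite expfz_neq0.
have q2i i : q ^+ (2 * i) != 0 by rewrite expf_neq0.
have tA_eig i : (i <= d)%N -> lam a (tau + (d - i)) = eig_desc q s i.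
  move=> id; rewrite lamE /eig_desc /s /aw /aW /qpow -/d -/tau.
  have -> : exprz q ((2 * (tau + (d - i)))%N%:Z - D%:Z) =
      exprz q ((2 * tau + d)%N%:Z - D%:Z) * q ^+ d / q ^+ (2 * i).
    exact: expz_reindex_desc.
  exact: (eig_shift_desc a0 (qz _) qd (q2i i)).
have tB_eig i : (i <= d)%N -> lam b (rho + i) = dual_eig q t i.
  move=> id; rewrite lamE /dual_eig /t /bw /bW /qpow -/d -/rho.
  have -> : exprz q ((2 * (rho + i))%N%:Z - D%:Z) =
      exprz q ((2 * rho + d)%N%:Z - D%:Z) / q ^+ d * q ^+ (2 * i).
    exact: expz_reindex_asc.
  exact: (eig_shift_asc b0 (qz _) qd (q2i i)).
have qn_d i : (0 < i <= d)%N -> qn q i != 0.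
  move=> /andP[i0 id]; apply: qnD_neq0; rewrite i0 /=.
  by apply: leq_trans id (leq_trans (leq_addl _ _) rdD).
have w1E : (Es rho *m Ab)^T = Ab *m Es rho by rewrite trmx_mul Ab_sym Es_sym.
have tr : restr_trace W (Es rho *m Ab) = a1.
  have [|||//|e] := @restr_trace_rank1 _ _ W (Es rho) Ab w1 a1; last by rewrite e eqxx in w0.
  - exact: submx_trans w1W (W_Es rho).
  - by rewrite w1E mulmxA.
  rewrite w1E mulmxA; apply: submx_trans (submxMr _ W_A) _.
  apply/row_subP => k; have [c ->] := rank1_span (W_thin rho) w0 w1W (row_sub k _).
  exact: scalemx_sub.
have hk : (0 < d)%N -> kap = s / t / q ^+ d / q + t / s * q ^+ d * q +
     (dual_eig q t 0 - dual_eig q t 1) * (a1 - eig_desc q s 0) / (qn q 1 * qn q d).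
  move=> d0; rewrite /kap /kappa -/d gtn_eqF // -/aw -/bw /phi1 tr -/rho.
  have -> : varthetas adj x D q b W 0 = dual_eig q t 0.
    rewrite /varthetas -/d -/bw /dual_eig /qpow muln0 sub0r subr0 -invr_expz -exprnP.
    rewrite expr0 invr1 !mulr1 /t. 
    by rewrite invf_div [q ^+ d / bw]mulrC.
  have -> : varthetas adj x D q b W 1 = dual_eig q t 1.
    rewrite /varthetas -/d -/bw /dual_eig /qpow muln1 -(opprB 2%N%:Z) -invr_expz.
    rewrite expfzDr // -invr_expz -!exprnP /t.
    exact: (dual_eig1_shift bW_neq0 qd q0).
  have -> : vartheta adj x D E q a W d = eig_desc q s 0.
    rewrite /vartheta -/d -/aw /eig_desc /qpow expz_dbl_sub expz_sub_dbl.
    by rewrite muln0 expr0 invr1 !mulr1 /s (invfM aw).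
  have -> : qpow q (d%:Z - 1) = q ^+ d / q by rewrite /qpow expfzDr // exprN1 -exprnP.
  have -> : qpow q (1 - d%:Z) = q / q ^+ d by rewrite /qpow expfzDr // -invr_expz -exprnP expr1z.
  rewrite /qn expr1 /s /t; congr (_ + _ + _).
  - exact: (kappa_term1 _ bW_neq0 qd q0).
  - by apply: kappa_term2 => //; apply: aW_neq0.
have := thin_aw Ei_mul Ei_sum A_Ei Ei_B_Ei Es_out (Es_mul C adj x) (sum_Es C DE x)
  Es_B B_Es Es_A_Es' W_Ei W_Es W_A W_B W_irr W_thin rdD tdD supps supp w0 w1W
  (et := eig_desc q s) q0 s0 t0 q4 (fun i => erefl) tA_eig tB_eig tA_inj tB_inj qn_d ha1 hk.
by rewrite /s /t mulfK // divfK.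
Qed.
End Module.

(** All three numbers are read off from ranks of E_i W and E*_i W; these matrices lie in T, so an
    isomorphism preserves the ranks. *)
Lemma Tiso_params W1 W2 : irreducible A As W1 -> Tiso A As W1 W2 ->
  [/\ endpoint adj x D W1 = endpoint adj x D W2,
      dual_endpoint D E W1 = dual_endpoint D E W2 &
      mod_diam adj x D W1 = mod_diam adj x D W2].
Proof.
move=> [mW1 _ _] iso.
have eEs : {in iota 0 D.+1, forall i, (dimEstar adj x W1 i != 0%N) = (dimEstar adj x W2 i != 0%N)}.
  move=> i; rewrite mem_iota add0n ltnS => /andP[_ iD]; rewrite /dimEstar (Tiso_rank mW1 iso) //.
  exact: (inT_Es sg conn DE E_prim E_inj dr D0 E0 Qp As_ths).
have eE : {in iota 0 D.+1, forall i,
    (\rank (W1 *m (E i)^T) != 0%N) = (\rank (W2 *m (E i)^T) != 0%N)}.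
  move=> i; rewrite mem_iota add0n ltnS => /andP[_ iD]; rewrite (Tiso_rank mW1 iso) //.
  exact: (inT_E sg conn DE E_prim E_inj A_th).
split; first exact: eq_in_find; first exact: eq_in_find.
by rewrite /mod_diam; congr (_.-1); apply: eq_in_count.
Qed.

Variables (abold bbold cbold Lam : 'M[C]_n) (cW : 'M[C]_n -> C).
Hypothesis all_thin : forall W, irreducible A As W -> thin adj x W.
Hypothesis abold_acts : acts_as_scalar A As (aW adj x D E q a) abold.
Hypothesis bbold_acts : acts_as_scalar A As (bW adj x D q b) bbold.
Hypothesis Lam_acts : acts_as_scalar A As (fun W => q ^+ (mod_diam adj x D W).+1) Lam.
Hypothesis cW_root : forall W, irreducible A As W ->
  cW W ^+ 2 - kappa adj x D E q a b Ab W * cW W + 1 = 0.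
Hypothesis cW_iso : forall W1 W2, irreducible A As W1 -> irreducible A As W2 ->
  Tiso A As W1 W2 -> cW W1 = cW W2.
Hypothesis cbold_acts : acts_as_scalar A As cW cbold.

Let cW_neq0 W : irreducible A As W -> cW W != 0.
Proof.
move=> /cW_root; apply: contra_eq_neq => ->.
by rewrite expr0n mulr0 subrr add0r oner_neq0.
Qed.

Let cW_kappa W : irreducible A As W -> cW W + (cW W)^-1 = kappa adj x D E q a b Ab W.
Proof.
move=> iW; apply: (mulIf (cW_neq0 iW)); rewrite mulrDl mulVf ?cW_neq0 //.
by apply/eqP; rewrite -subr_eq0 -(cW_root iW); apply/eqP; ring.
Qed.

Let acts_addV f M : acts_as_scalar A As f M -> (forall W, irreducible A As W -> f W != 0) ->
  acts_as_scalar A As (fun W => f W + (f W)^-1) (M + invmx M).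
Proof.
move=> hM f0; apply: (acts_scalarD hM).
exact: (acts_scalar_inv hermA hermAs hM f0).
Qed.

Let a_acts := acts_addV abold_acts (fun W _ => aW_neq0 W).
Let b_acts := acts_addV bbold_acts (fun W _ => bW_neq0 W).
Let c_acts := acts_addV cbold_acts cW_neq0.
Let L_acts := acts_addV Lam_acts (fun W _ => expf_neq0 _ q0).

Let rhs_acts (f g h : 'M[C]_n -> C) (M N P : 'M[C]_n) :
  acts_as_scalar A As f M -> acts_as_scalar A As g N -> acts_as_scalar A As h P ->
  acts_as_scalar A As (fun W => (q + q^-1)^-1 *
    (f W * (q ^+ (mod_diam adj x D W).+1 + q ^- (mod_diam adj x D W).+1) + g W * h W))
    ((q + q^-1)^-1 *: (M *m (Lam + invmx Lam) + N *m P)).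
Proof.
move=> hM hN hP; apply: acts_scalarZ.
by apply: acts_scalarD; apply: acts_scalarM.
Qed.

Let G3 := (q + q^-1)^-1 *: ((cbold + invmx cbold) *m (Lam + invmx Lam)
  + (abold + invmx abold) *m (bbold + invmx bbold)).
Let dq := (q ^+ 2 - q ^- 2)^-1.
Let Cb := G3 + (- dq) *: (q *: (Ab *m Bb) - q^-1 *: (Bb *m Ab)).

Let gam W := aw_gamma q (mod_diam adj x D W) (kappa adj x D E q a b Ab W)
  (aW adj x D E q a W) (bW adj x D q b W).

Let G3_acts : acts_as_scalar A As gam G3.
Proof.
move=> W iW; rewrite (rhs_acts c_acts a_acts b_acts iW) cW_kappa //.
by rewrite /gam /aw_gamma mulrC.
Qed.

Let inT_Ab : inT A As Ab.
Proof. by apply/inTscale/inT_sub; [exact: inTA|rewrite -scalemx1; apply/inTscale/inT1]. Qed.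

Let inT_Bb : inT A As Bb.
Proof. by apply/inTscale/inT_sub; [exact: inTAs|rewrite -scalemx1; apply/inTscale/inT1]. Qed.

(** The right-hand side [G3] lies in T by the bicommutant theorem, as its scalar depends only on the
    isomorphism class; the rest is a polynomial in A and A*. *)
Let inT_Cb : inT A As Cb.
Proof.
apply: inTadd; last by apply/inTscale/inT_sub; apply/inTscale/inTmul.
apply: (acts_scalar_inT hermA hermAs (rhs_acts c_acts a_acts b_acts)) => W1 W2 i1 i2 iso.
have [e1 e2 e3] := Tiso_params i1 iso.
by rewrite /aW /bW e1 e2 e3 (cW_iso i1 i2 iso).
Qed.

(** Acting on rows reverses products, so C is met directly after [W] or after [W] times [Bb] or
    [Ab]; these are the cases [X = 1], [Bb], [Ab]. The rows of [W *m X^T] stay in [W], where [G3]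
    acts as [gam W]. *)
Let Cb_W W (X : 'M[C]_n) : irreducible A As W -> inT A As X ->
  W *m X^T *m Cb^T = gam W *: (W *m X^T)
    - dq *: (q *: (W *m X^T *m Bb *m Ab) - q^-1 *: (W *m X^T *m Ab *m Bb)).
Proof.
move=> iW hX; have [mW _ _] := iW; have /submxP[Y eY] := mW _ hX.
rewrite /Cb trmx_qcomm Ab_sym Bb_sym mulmx_qcomm scaleNr; congr (_ - _).
by rewrite eY -mulmxA G3_acts // scalemxAr.
Qed.

Lemma qracah_relations :
  exists! Cb : 'M[C]_n,
    [/\ inT A As Cb,
     Ab + (q ^+ 2 - q ^- 2)^-1 *: (q *: (Bb *m Cb) - q^-1 *: (Cb *m Bb))
       = (q + q^-1)^-1 *: ((abold + invmx abold) *m (Lam + invmx Lam)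
                           + (bbold + invmx bbold) *m (cbold + invmx cbold)),
     Bb + (q ^+ 2 - q ^- 2)^-1 *: (q *: (Cb *m Ab) - q^-1 *: (Ab *m Cb))
       = (q + q^-1)^-1 *: ((bbold + invmx bbold) *m (Lam + invmx Lam)
                           + (cbold + invmx cbold) *m (abold + invmx abold)) &
     Cb + (q ^+ 2 - q ^- 2)^-1 *: (q *: (Ab *m Bb) - q^-1 *: (Bb *m Ab))
       = (q + q^-1)^-1 *: ((cbold + invmx cbold) *m (Lam + invmx Lam)
                           + (abold + invmx abold) *m (bbold + invmx bbold))].
Proof.
exists Cb; split; last first.
  by move=> C' [_ _ _ e3]; rewrite /Cb /G3 -e3 scaleNr addrK.
split; first exact: inT_Cb; last by rewrite /Cb scaleNr subrK.
(* The right-hand side acts as a scalar on each irreducible module, so it suffices that the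
   left-hand side acts there by the same scalar. *)
- apply: (acts_scalar_ext hermA hermAs) (rhs_acts a_acts b_acts c_acts) => W iW.
  have [e _] := module_aw iW (all_thin iW).
  have CW := Cb_W iW (inT1 A As); rewrite trmx1 mulmx1 in CW.
  have CB := Cb_W iW inT_Bb; rewrite Bb_sym in CB.
  rewrite cW_kappa // trmx_qcomm Ab_sym Bb_sym mulmx_qcomm CB CW.
  rewrite mulmxBl -!scalemxAl mulmxBl -!scalemxAl.
  rewrite (qcomm_subst _ _ _ _ _ _ _ q0).
  by apply: etrans e _; rewrite /aw_alpha mulrC.
- apply: (acts_scalar_ext hermA hermAs) (rhs_acts b_acts c_acts a_acts) => W iW.
  have [_ e] := module_aw iW (all_thin iW).
  have CW := Cb_W iW (inT1 A As); rewrite trmx1 mulmx1 in CW.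
  have CA := Cb_W iW inT_Ab; rewrite Ab_sym in CA.
  rewrite cW_kappa // trmx_qcomm Ab_sym Bb_sym mulmx_qcomm CA CW.
  rewrite mulmxBl -!scalemxAl mulmxBl -!scalemxAl.
  rewrite (qcomm_subst _ _ _ _ _ _ _ q0).
  apply: etrans e _; rewrite /aw_alpha mulrC.
  by rewrite [_ * kappa _ _ _ _ _ _ _ _ _]mulrC.
Qed.
End QRacahModule.

Unset Implicit Arguments.

Theorem theorem5p12 (R : realType) (n : nat) (adj : rel 'I_n) (D : nat)
  (q : R[i]) (E : nat -> 'M[R[i]]_n) (x : 'I_n)
  (w u v ws us vs a b : R[i])
  (abold bbold cbold Lam : 'M[R[i]]_n) (cW : 'M[R[i]]_n -> R[i]) :
  (* q *)
  q != 0 -> q ^+ 4 != 1 ->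
  (* Gamma: finite connected distance-regular graph of diameter D >= 3 *)
  simple_graph adj -> gconnected adj -> distance_regular adj ->
  D = diam adj -> (3 <= D)%N ->
  (* E_0..E_D: the primitive idempotents of the Bose-Mesner algebra *)
  (forall i, (i <= D)%N -> prim_idem adj (E i)) ->
  (forall i j, (i <= D)%N -> (j <= D)%N -> E i = E j -> i = j) ->
  (forall F, prim_idem adj F -> exists2 i, (i <= D)%N & F = E i) ->
  E 0%N = (n%:R)^-1 *: const_mx 1 ->
  Qpolynomial E D ->
  (* q-Racah type *)
  u != 0 -> us != 0 -> v != 0 -> vs != 0 ->
  adjmx R[i] adj = \sum_(i < D.+1)
      (w + u * qpow q ((2 * i)%N%:Z - D%:Z) + v * qpow q (D%:Z - (2 * i)%N%:Z)) *: E i ->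
  Astarmx (E 1%N) x = \sum_(i < D.+1)
      (ws + us * qpow q ((2 * i)%N%:Z - D%:Z) + vs * qpow q (D%:Z - (2 * i)%N%:Z))
        *: Estar R[i] adj x i ->
  a ^+ 2 = u / v -> b ^+ 2 = us / vs ->
  let A := adjmx R[i] adj in
  let As := Astarmx (E 1%N) x in
  let Abold := (a * v)^-1 *: (A - w%:M) in
  let Bbold := (b * vs)^-1 *: (As - ws%:M) in
  (* every irreducible T-module is thin *)
  (forall W, irreducible A As W -> thin adj x W) ->
  (* the operators a, b, c, Lambda: on each irreducible W (hence on V_psi)
     they act as a(W), b(W), c(W), q^(d(W)+1) *)
  acts_as_scalar A As (aW adj x D E q a) abold ->
  acts_as_scalar A As (bW adj x D q b) bbold ->
  acts_as_scalar A As (fun W => q ^+ (mod_diam adj x D W).+1) Lam ->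
  (* c(W): a root of xi^2 - kappa xi + 1, fixed on each isomorphism class *)
  (forall W, irreducible A As W ->
     cW W ^+ 2 - kappa adj x D E q a b Abold W * cW W + 1 = 0) ->
  (forall W1 W2, irreducible A As W1 -> irreducible A As W2 ->
     Tiso A As W1 W2 -> cW W1 = cW W2) ->
  acts_as_scalar A As cW cbold ->
  exists! Cb : 'M[R[i]]_n,
    [/\ inT A As Cb,
     Abold + (q ^+ 2 - q ^- 2)^-1 *: (q *: (Bbold *m Cb) - q^-1 *: (Cb *m Bbold))
       = (q + q^-1)^-1 *: ((abold + invmx abold) *m (Lam + invmx Lam)
                           + (bbold + invmx bbold) *m (cbold + invmx cbold)),
     Bbold + (q ^+ 2 - q ^- 2)^-1 *: (q *: (Cb *m Abold) - q^-1 *: (Abold *m Cb))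
       = (q + q^-1)^-1 *: ((bbold + invmx bbold) *m (Lam + invmx Lam)
                           + (cbold + invmx cbold) *m (abold + invmx abold)) &
     Cb + (q ^+ 2 - q ^- 2)^-1 *: (q *: (Abold *m Bbold) - q^-1 *: (Bbold *m Abold))
       = (q + q^-1)^-1 *: ((cbold + invmx cbold) *m (Lam + invmx Lam)
                           + (abold + invmx abold) *m (bbold + invmx bbold))].
Proof.
move=> q0 q4 sg conn dr DE D3 Eprim Einj _ E0 Qp u0 us0 v0 vs0 Adec Asdec a2 b2.
move=> A As Abold Bbold thinW ha hb hL hcr hci hc.
exact: (qracah_relations q0 q4 sg conn dr DE (ltnW (ltnW D3)) Eprim Einj E0 Qp
  u0 us0 v0 vs0 Adec Asdec a2 b2 thinW ha hb hL hcr hci hc).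
Qed.
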